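(* Fix an integer $d\ge 2$ and $\lambda>0$. If the single-center dynamics for the hard sphere model on $\mathbb{R}^d$ has optimal temporal mixing at fugacity $\lambda$, then the hard sphere model on $\mathbb{R}^d$ at fugacity $\lambda$ exhibits strong spatial mixing.
   Context: Let $r=r_d>0$ be the radius for which a ball of radius $r$ in $\mathbb{R}^d$ has volume $1$; $B_\ell(x)$ is the open ball of radius $\ell$ about $x$, and $|A|$ is Lebesgue measure. For compact measurable $\Lambda\subset\mathbb{R}^d$ let $\Lambda_{\mathrm{Int}}=\{x\in\Lambda:\mathrm{dist}(x,\Lambda^c)\ge r\}$. A boundary condition is a (measurable) set $\tau\subseteq\Lambda_{\mathrm{Int}}$ of forbidden locations for centers. $\Omega_\Lambda$ is the set of all finite point sets in $\Lambda_{\mathrm{Int}}$ with pairwise distances at least $2r$, and $\Omega_\Lambda^\tau\subseteq\Omega_\Lambda$ is the set of those contained in $\Lambda_{\mathrm{Int}}\setminus\tau$. The hard sphere model $\mu_\Lambda^\tau$ at fugacity $\lambda$ with boundary condition $\tau$ is the law of a Poisson point process of intensity $\lambda$ on $\Lambda_{\mathrm{Int}}\setminus\tau$ conditioned on all points being at pairwise distance at least $2r$. For $\Lambda'\subseteq\Lambda$ and probability measures $\mu_1,\mu_2$ on $\Omega_\Lambda$, $\|\mu_1-\mu_2\|_{\Lambda'}$ is the total variation distance between the pushforwards of $\mu_1,\mu_2$ to $\Omega_{\Lambda'}$ under the projection $X\mapsto X\cap\Lambda'_{\mathrm{Int}}$. Strong spatial mixing (SSM): the hard sphere model at fugacity $\lambda$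 exhibits strong spatial mixing on $\mathbb{R}^d$ if there exist $\alpha,\beta>0$ such that for all compact measurable $\Lambda'\subseteq\Lambda\subset\mathbb{R}^d$ and any pair of boundary conditions $\tau,\tau'$ on $\Lambda$, $$\|\mu_\Lambda^\tau-\mu_\Lambda^{\tau'}\|_{\Lambda'}\le\beta|\Lambda'|\exp(-\alpha\cdot\mathrm{dist}(\tau\triangle\tau',\Lambda')).$$ Single-center dynamics: for $|\Lambda|>0$ this is the Markov chain on $\Omega_\Lambda^\tau$ which, given $X_t$, forms $X_{t+1}$ as follows. (1) Pick $x\in\Lambda$ uniformly at random. (2) With probability $1/(1+\lambda)$ set $X_{t+1}=X_t\setminus B_r(x)$. (3) With probability $\lambda/(1+\lambda)$, let $X'=X_t\cup\{x\}$; set $X_{t+1}=X'$ if $X'\in\Omega_\Lambda^\tau$, and $X_{t+1}=X_t$ otherwise. Optimal temporal mixing: the single-center dynamics on $\mathbb{R}^d$ has optimal temporal mixing at fugacity $\lambda$ if there exist $b,c>0$ such that for any compact measurable $\Lambda\subset\mathbb{R}^d$ (of positive volume), with $n=|\Lambda|$, any boundary condition $\tau$, any $s>0$, and any two instances $(X_t),(Y_t)$ of the single-center dynamics on $\Omega_\Lambda^\tau$ (with arbitrary initial distributions), the total variation distance between the laws of $X_{\lfloor sn\rfloor}$ and $Y_{\lfloor sn\rfloor}$ is at most $b\,n\,e^{-cs}$. *)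

(* Defs.v *)
From HB Require Import structures.
From mathcomp Require Import all_boot all_order all_algebra.
From mathcomp Require Import finmap.
From mathcomp Require Import all_classical all_reals all_analysis measurable_realfun.

Set Implicit Arguments.
Unset Strict Implicit.
Unset Printing Implicit Defensive.

Import Order.TTheory GRing.Theory Num.Theory.
Import numFieldNormedType.Exports.

Local Open Scope classical_set_scope.
Local Open Scope ring_scope.

Section pushforward_section.
Context d d' (T : measurableType d) (U : measurableType d') (R : realType).
Variables (mu : {measure set T -> \bar R}) (f : T -> U) (g : U -> T).
Hypotheses (mf : measurable_fun setT f) (mg : measurable_fun setT g).
Hypothesis fK : cancel f g.

Lemma pushforward_sigma_finite :
  sigma_finite setT mu -> sigma_finite setT (pushforward mu f).
Proof.
move=> [F UF mF]; exists (fun i => g @^-1` F i).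
  by rewrite -preimage_bigcup -UF preimage_setT.
move=> i; split.
  by rewrite -[X in measurable X]setTI; apply: mg => //; exact: (mF i).1.
rewrite /pushforward -comp_preimage (_ : g \o f = id) ?(mF i).2//.
by apply/funext => x /=; rewrite fK.
Qed.

End pushforward_section.

Section sigma_finite_restriction.
Context d (T : measurableType d) (R : realType).
Variables (mu : {sigma_finite_measure set T -> \bar R}) (D : set T).
Hypothesis mD : measurable D.

Let mrestr_sigma_finite : sigma_finite setT (mrestr mu mD).
Proof.
have [F UF mF] := sigma_finiteT mu; exists F => // i.
split; first exact: (mF i).1.
rewrite /mrestr (le_lt_trans _ (mF i).2)// le_measure ?inE//.
- by apply: measurableI => //; exact: (mF i).1.
- exact: (mF i).1.
Qed.

(* An alias of [mrestr] carrying a sigma-finite structure. *)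
Definition smrestr := mrestr mu mD.
HB.instance Definition _ := Measure.on smrestr.
HB.instance Definition _ :=
  Measure_isSigmaFinite.Build _ _ _ smrestr mrestr_sigma_finite.
End sigma_finite_restriction.

Lemma product_measure1_sigma_finite d1 d2 (T1 : measurableType d1)
    (T2 : measurableType d2) (R : realType)
    (m1 : {sigma_finite_measure set T1 -> \bar R})
    (m2 : {sigma_finite_measure set T2 -> \bar R}) :
  sigma_finite setT (m1 \x m2)%E.
Proof.
have /sigma_finiteP[F [TF ndF Foo]] := sigma_finiteT m1.
have /sigma_finiteP[G [TG ndG Goo]] := sigma_finiteT m2.
exists (fun n => F n `*` G n).
  rewrite -setXTT TF TG predeqE => -[x y]; split.
    move=> [/= [n _ Fnx] [k _ Gky]]; exists (maxn n k) => //; split.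
    - by move: x Fnx; exact/subsetPset/ndF/leq_maxl.
    - by move: y Gky; exact/subsetPset/ndG/leq_maxr.
  by move=> [n _ []/= ? ?]; split; exists n.
move=> k; have [? ?] := Foo k; have [? ?] := Goo k.
split; first exact: measurableX.
by rewrite product_measure1E// lte_mul_pinfty// ge0_fin_numE.
Qed.

Section power_measure.
Context d (T : measurableType d) (R : realType).

Definition tcons n (p : T * n.-tuple T) : n.+1.-tuple T :=
  [tuple of p.1 :: p.2].
Definition tuncons n (t : n.+1.-tuple T) : T * n.-tuple T :=
  (thead t, [tuple of behead t]).

Lemma measurable_tcons n : measurable_fun setT (@tcons n).
Proof. exact: measurable_cons. Qed.

Lemma measurable_tuncons n : measurable_fun setT (@tuncons n).
Proof.
apply: measurable_fun_pair; first exact: measurable_tnth.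
exact: measurable_behead.
Qed.

Lemma tconsK n : cancel (@tcons n) (@tuncons n).
Proof. case=> x t; congr pair; exact/val_inj. Qed.

Section cons_measure.
Variables (mu : {sigma_finite_measure set T -> \bar R}) (n : nat)
  (nu : {sigma_finite_measure set (n.-tuple T) -> \bar R}).

Definition cons_measure : set (n.+1.-tuple T) -> \bar R :=
  pushforward (mu \x nu)%E (@tcons n).

HB.instance Definition _ := isMeasurableFun.Build _ _ _ _ (@tcons n)
  (@measurable_tcons n).

Let cons_measure0 : cons_measure set0 = 0%E.
Proof. by rewrite /cons_measure /pushforward preimage_set0 measure0. Qed.

Let cons_measure_ge0 A : (0 <= cons_measure A)%E.
Proof. by rewrite /cons_measure /pushforward measure_ge0. Qed.

Let cons_measure_sigma_additive : semi_sigma_additive cons_measure.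
Proof.
exact: (@measure_semi_sigma_additive _ _ _
  (pushforward (mu \x nu)%E (@tcons n))).
Qed.

HB.instance Definition _ := isMeasure.Build _ _ _ cons_measure
  cons_measure0 cons_measure_ge0 cons_measure_sigma_additive.

Let cons_measure_sigma_finite : sigma_finite setT cons_measure.
Proof.
apply: (pushforward_sigma_finite (@measurable_tuncons n) (@tconsK n)).
exact: product_measure1_sigma_finite.
Qed.

HB.instance Definition _ := Measure_isSigmaFinite.Build _ _ _ cons_measure
  cons_measure_sigma_finite.
End cons_measure.

(* The n-fold product mu \x ... \x mu on n-tuples. *)
Fixpoint power_measure (mu : {sigma_finite_measure set T -> \bar R}) n :
    {sigma_finite_measure set (n.-tuple T) -> \bar R} :=
  match n with
  | 0 => \d_([tuple])
  | n'.+1 => cons_measure mu (power_measure mu n')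
  end.

End power_measure.

(* 'rV[R]_n is equipped with its Borel sigma-algebra. *)
HB.instance Definition _ (R : realType) (n : nat) :=
  @isMeasurable.Build (sigma_display (@open 'rV[R]_n)) 'rV[R]_n
    <<s @open 'rV[R]_n >> (@sigma_algebra0 _ setT _) (@sigma_algebraC _ _)
    (@sigma_algebra_bigcup _ setT _).

Section euclidean_space.
Context (R : realType) (d : nat).
Local Notation E := 'rV[R]_d.

Lemma open_measurable_rV (A : set E) : open A -> measurable A.
Proof. exact: sub_sigma_algebra. Qed.

Lemma closed_measurable_rV (A : set E) : closed A -> measurable A.
Proof.
by move=> /closed_openC/open_measurable_rV/measurableC; rewrite setCK.
Qed.

Lemma measurable_coord (i : 'I_d) : measurable_fun setT (fun x : E => x ord0 i).
Proof.
apply: (measurability _ (RGenOpens.measurableE R)).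
move=> _ [_ [a [b ->]] <-]; rewrite setTI; apply: open_measurable_rV.
apply: open_comp; last exact: interval_open.
by move=> x _; exact: coord_continuous.
Qed.

Definition row_of_tuple (t : d.-tuple (measurableTypeR R)) : E :=
  \row_i tnth t i.
Definition tuple_of_row (x : E) : d.-tuple (measurableTypeR R) :=
  [tuple x ord0 i | i < d].

Lemma row_of_tupleK : cancel row_of_tuple tuple_of_row.
Proof. by move=> t; apply: eq_from_tnth => i; rewrite tnth_mktuple mxE. Qed.

Lemma measurable_tuple_of_row : measurable_fun setT tuple_of_row.
Proof.
apply/measurable_fun_tnthP => i; rewrite (_ : _ \o _ = fun x : E => x ord0 i).
  exact: measurable_coord.
by apply/funext => x /=; rewrite tnth_mktuple.
Qed.

Lemma measurable_row_of_tuple : measurable_fun setT row_of_tuple.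
Proof.
apply: (@measurability _ _ _ _ _ _ (@open E)) => //.
move=> _ [U oU <-]; rewrite setTI.
pose B (q : {ffun 'I_d -> rat}) (k : nat) :
    set (d.-tuple (measurableTypeR R)) :=
  \bigcap_(i in [set: 'I_d]) [set t | `|ratr (q i) - tnth t i| < k.+1%:R^-1].
pose F (qk : {ffun 'I_d -> rat} * nat) :=
  if pselect (B qk.1 qk.2 `<=` row_of_tuple @^-1` U)
  then B qk.1 qk.2 else set0.
rewrite (_ : _ @^-1` _ = \bigcup_qk F qk).
  apply: countable_bigcupT_measurable => // -[q k]; rewrite /F.
  case: pselect => [qkU|qkU] /=; last exact: measurable0.
  apply: fin_bigcap_measurable => [|i _]; first exact: finite_finset.
  rewrite -[X in measurable X]setTI.
  rewrite (_ : [set t | _] =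
    (fun t : d.-tuple (measurableTypeR R) => `|ratr (q i) - tnth t i|) @^-1`
      `]-oo, k.+1%:R^-1[).
    suff m : measurable_fun setT
        (fun t : d.-tuple (measurableTypeR R) => `|ratr (q i) - tnth t i|).
      by apply: m.
    apply: measurableT_comp => //; apply: measurable_funB => //.
    exact: measurable_tnth.
  by apply/seteqP; split => t /=; rewrite in_itv.
apply/seteqP; split=> [t Ut|t [qk _]]; last first.
  by rewrite /F; case: pselect => [h /= Bt|h //]; exact: h.
have : nbhs (row_of_tuple t) U by exact: open_nbhs_nbhs.
move=> /nbhs_ballP[e /= e0 eU].
have [k ke] : exists k : nat, k.+1%:R^-1 < e / 2.
  exists (Num.truncn (e / 2)^-1); rewrite invf_plt ?posrE ?divr_gt0//.
  by rewrite truncnS_gt// ?invr_ge0 ?divr_ge0// ltW.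
have k0 : 0 < k.+1%:R^-1 :> R by rewrite invr_gt0.
have hq i : exists q : rat, `|ratr q - tnth t i| < k.+1%:R^-1.
  have : tnth t i - k.+1%:R^-1 < tnth t i + k.+1%:R^-1.
    by rewrite ltrBlDr -addrA ltrDl addr_gt0.
  by move=> /rat_in_itvoo[q]; rewrite in_itv/= => qt; exists q; rewrite ltr_distl.
pose q := [ffun i => sval (cid (hq i))].
have qt i : `|ratr (q i) - tnth t i| < k.+1%:R^-1 by rewrite ffunE; case: cid.
exists (q, k) => //; rewrite /F; case: pselect => [h i _|h /=].
  exact: qt.
apply: h => s Bs; apply: eU; split => // i j; rewrite !mxE.
rewrite /ball/= (splitr e) (le_lt_trans (ler_distD (ratr (q j)) _ _))// ltrD//.
  by rewrite distrC (lt_trans (qt j)).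
by rewrite (lt_trans _ ke)//; exact: Bs.
Qed.

Definition lebesgue_rV : set E -> \bar R :=
  pushforward (power_measure (@lebesgue_measure R) d) row_of_tuple.

Section lebesgue_rV_measure.
HB.instance Definition _ := isMeasurableFun.Build _ _ _ _ row_of_tuple
  measurable_row_of_tuple.

Let lebesgue_rV0 : lebesgue_rV set0 = 0%E.
Proof. by rewrite /lebesgue_rV /pushforward preimage_set0 measure0. Qed.

Let lebesgue_rV_ge0 A : (0 <= lebesgue_rV A)%E.
Proof. by rewrite /lebesgue_rV /pushforward measure_ge0. Qed.

Let lebesgue_rV_sigma_additive : semi_sigma_additive lebesgue_rV.
Proof.
exact: (@measure_semi_sigma_additive _ _ _
  (pushforward (power_measure (@lebesgue_measure R) d) row_of_tuple)).
Qed.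

HB.instance Definition _ := isMeasure.Build _ _ _ lebesgue_rV
  lebesgue_rV0 lebesgue_rV_ge0 lebesgue_rV_sigma_additive.
End lebesgue_rV_measure.

Let lebesgue_rV_sigma_finite : sigma_finite setT lebesgue_rV.
Proof.
apply: (pushforward_sigma_finite measurable_tuple_of_row row_of_tupleK).
exact: sigma_finiteT.
Qed.

HB.instance Definition _ := Measure_isSigmaFinite.Build _ _ _ lebesgue_rV
  lebesgue_rV_sigma_finite.

(* The library norm on 'rV[R]_d is the sup norm, hence this definition. *)
Definition euclidean_dist (x y : E) : R :=
  Num.sqrt (\sum_i (x ord0 i - y ord0 i) ^+ 2).

Definition euclidean_ball (x : E) (l : R) : set E := [set y | euclidean_dist x y < l].

(* Equal to +oo when A or B is empty. *)
Definition set_dist (A B : set E) : \bar R :=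
  ereal_inf [set (euclidean_dist x y)%:E | x in A & y in B].

Definition r_interior (r : R) (L : set E) : set E :=
  [set x | L x /\ (r%:E <= set_dist [set x] (~` L))%E].

Lemma measurable_euclidean_dist :
  measurable_fun setT (fun p : E * E => euclidean_dist p.1 p.2).
Proof.
rewrite /euclidean_dist; apply: (measurableT_comp (f := @Num.sqrt R)).
  by apply: continuous_measurable_fun; exact: sqrt_continuous.
apply: measurable_sum => i.
apply: (measurable_funX (f := fun p : E * E => p.1 ord0 i - p.2 ord0 i)).
apply: (measurable_funB (f := fun p : E * E => p.1 ord0 i)
                        (g := fun p : E * E => p.2 ord0 i)).
  exact: (measurableT_comp (measurable_coord i) measurable_fst).
exact: (measurableT_comp (measurable_coord i) measurable_snd).
Qed.

Lemma euclidean_dist_continuous (y : E) : continuous (fun x : E => euclidean_dist x y).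
Proof.
move=> x; apply: (@continuous_comp _ _ _
  (fun x : E => \sum_i (x ord0 i - y ord0 i) ^+ 2)); last first.
  exact: sqrt_continuous.
apply: (@continuous_big _ _ _ _ _ add_continuous) => //= i _ {}x.
apply: (@continuous_comp _ _ _ (fun x : E => x ord0 i - y ord0 i)
  (fun t => t ^+ 2)); last exact: exprn_continuous.
by apply: continuousB; [exact: coord_continuous|exact: cst_continuous].
Qed.

Lemma measurable_r_interior r (L : set E) :
  measurable L -> measurable (r_interior r L).
Proof.
move=> mL; rewrite (_ : r_interior r L =
    L `&` \bigcap_(y in ~` L) [set x | r <= euclidean_dist x y]).
  apply: measurableI => //; apply: closed_measurable_rV.
  apply: closed_bigI => y _.
  apply: (@closed_comp _ _ (fun x : E => euclidean_dist x y) [set t | r <= t]).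
    by move=> x _; exact: euclidean_dist_continuous.
  exact: closed_ge.
apply/seteqP; split => [x [Lx rx]|x [Lx rx]]; split => //.
  move=> y Ly /=; rewrite -lee_fin (le_trans rx)//.
  by apply: ereal_inf_lbound; exists x => //; exists y.
by apply: le_ereal_inf_tmp => _ [_ -> [y Ly <-]]; rewrite lee_fin; exact: rx.
Qed.

End euclidean_space.

Definition config (R : realType) (d : nat) := {fset 'rV[R]_d}.

HB.instance Definition _ (R : realType) (d : nat) := Choice.on (config R d).
HB.instance Definition _ (R : realType) (d : nat) :=
  isPointed.Build (config R d) fset0.

Definition num_points (R : realType) (d : nat) (A : set 'rV[R]_d)
  (X : config R d) : nat := #|` [fset x in X | x \in A]%fset|.

(* Configurations carry the sigma-algebra generated by the counts of points in
   Borel sets. *)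
Definition count_events (R : realType) (d : nat) : set (set (config R d)) :=
  [set [set X | num_points A X = n] | A in measurable & n in [set: nat]].

HB.instance Definition _ (R : realType) (d : nat) :=
  @isMeasurable.Build (sigma_display (@count_events R d)) (config R d)
    <<s @count_events R d >> (@sigma_algebra0 _ setT _) (@sigma_algebraC _ _)
    (@sigma_algebra_bigcup _ setT _).

Section configurations.
Context (R : realType) (d : nat).
Local Notation E := 'rV[R]_d.
Local Notation config := (config R d).

Definition hard_core (r : R) (X : config) : Prop :=
  forall x y, x \in X -> y \in X -> x != y -> 2 * r <= euclidean_dist x y.

(* With D the set of admissible centers this is Omega_L (or Omega_L^t); the
   trace of the sigma-algebra of [config] makes it a measurable space. *)
Definition packings (r : R) (D : set E) : set config :=
  [set X | (forall x, x \in X -> D x) /\ hard_core r X].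

Definition restrict_config (A : set E) (X : config) : config :=
  [fset x in X | x \in A]%fset.

Definition insert_center (p : config * E) : config := (p.2 |` p.1)%fset.

Definition delete_ball (r : R) (p : config * E) : config :=
  [fset y in p.1 | y \notin euclidean_ball p.2 r]%fset.

Definition config_of_tuple (k : nat) (t : k.-tuple E) : config :=
  [fset x in tval t]%fset.

Lemma num_pointsE (A : set E) (X : config) :
  (num_points A X)%:R = \sum_(y <- X) \1_A y :> R.
Proof.
rewrite /num_points card_fset_sum1 natr_sum -big_fset_condE/= [LHS]big_mkcond/=.
by apply: eq_bigr => y _; rewrite indicE; case: ifP.
Qed.

Lemma measurable_num_points (A : set E) : measurable A ->
  measurable_fun setT (fun X : config => (num_points A X)%:R : R).
Proof.
move=> mA; apply: (@measurableT_comp _ _ _ _ _ _ (GRing.natmul (1 : R))) => //.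
move=> _ Y _; rewrite setTI.
rewrite (_ : _ @^-1` _ = \bigcup_(n in Y) [set X : config | num_points A X = n]).
  apply: bigcup_measurable => n _; apply: sub_sigma_algebra.
  by exists A => //; exists n.
apply/seteqP; split => [X YX|X [n Yn /= Xn]]; first by exists (num_points A X).
by rewrite /= Xn.
Qed.

Lemma measurable_config_fun dT (T : measurableType dT) (f : T -> config) :
  (forall A, measurable A ->
     measurable_fun setT (fun t => (num_points A (f t))%:R : R)) ->
  measurable_fun setT f.
Proof.
move=> mf; apply: (@measurability _ _ _ _ _ _ (@count_events R d)) => //.
move=> _ [_ [A mA [n _ <-]] <-]; rewrite setTI.
have := mf A mA measurableT [set n%:R] (measurable_set1 _); rewrite setTI.
congr measurable; apply/seteqP; split => t /=; last by move->.
by move=> /eqP; rewrite eqr_nat => /eqP.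
Qed.

Lemma measurable_num_points_section dT (T : measurableType dT)
    (C : set (T * E)) : measurable C ->
  measurable_fun setT
    (fun p : T * config => (num_points [set y | C (p.1, y)] p.2)%:R : R).
Proof.
pose phi (C : set (T * E)) (p : T * config) : R :=
  \sum_(y <- p.2) \1_C (p.1, y).
have phiE C' p : (num_points [set y | C' (p.1, y)] p.2)%:R = phi C' p.
  rewrite num_pointsE; apply: eq_bigr => y _; rewrite !indicE.
  by congr (_%:R); congr (nat_of_bool _); apply/idP/idP; rewrite !inE.
move=> mC; under eq_fun do rewrite phiE.
pose H := [set C | measurable C /\ measurable_fun setT (phi C)].
suff : measurable `<=` H by move=> /(_ _ mC) [].
rewrite measurable_prod_measurableType.
set G := [set A `*` B | A in measurable & B in measurable].
have GI : setI_closed G.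
  move=> _ _ [X1 mX1 [X2 mX2 <-]] [Y1 mY1 [Y2 mY2 <-]].
  exists (X1 `&` Y1); first exact: measurableI.
  by exists (X2 `&` Y2); [exact: measurableI|rewrite setXI].
have GH : G `<=` H.
  move=> _ [A mA [B mB <-]]; split; first exact: measurableX.
  rewrite (_ : phi _ = (fun p => \1_A p.1 * (num_points B p.2)%:R)).
    apply: measurable_funM.
      exact: (measurableT_comp (@measurable_indic _ _ _ _ A mA) measurable_fst).
    exact: (measurableT_comp (measurable_num_points mB) measurable_snd).
  apply/funext => p; rewrite num_pointsE /phi mulr_sumr; apply: eq_bigr => y _.
  rewrite !indicE -natrM mulnb; congr (_%:R); congr (nat_of_bool _).
  by apply/idP/andP; rewrite !inE.
suff HL : lambda_system setT H by exact: lambda_system_subset.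
split => //.
- by apply: GH; exists setT => //; exists setT => //; rewrite setXTT.
- move=> A B BA [mA mphiA] [mB mphiB]; split; first exact: measurableD.
  rewrite (_ : phi _ = phi A \- phi B); first exact: measurable_funB.
  apply/funext => p; rewrite /phi /= -sumrB; apply: eq_bigr => y _.
  rewrite !indicE; have [Bp|Bp] := pselect (B (p.1, y)).
    have Ap := BA _ Bp; rewrite (mem_set Ap) (mem_set Bp) subrr memNset//.
    by case.
  rewrite (memNset Bp) subr0; congr (_%:R); congr (nat_of_bool _).
  by apply/idP/idP; rewrite !inE //= => -[].
- move=> F ndF HF; split; first by apply: bigcupT_measurable => i; case: (HF i).
  apply: (@measurable_fun_cvg _ _ _ _ (fun n => phi (F n))).
    by move=> n; case: (HF n).
  move=> p _; apply: (@cvg_big _ _ _ _ _ add_continuous) => //= y _.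
  have [[n _ Fn]|nF] := pselect ((\bigcup_i F i) (p.1, y)).
    apply: (@cvg_near_cst _ _ _ _ _); exists n => // m /= nm.
    have Fm : F m (p.1, y) by move: Fn; apply/subsetPset/ndF.
    by rewrite !indicE (mem_set Fm) mem_set//; exists n.
  rewrite [X in _ --> X](_ : _ = 0); last by rewrite indicE memNset.
  apply: cvg_near_cst; apply: nearW => m.
  by rewrite indicE memNset// => Fm; apply: nF; exists m.
Qed.

Lemma measurable_close l :
  measurable [set p : E * E | euclidean_dist p.1 p.2 < l].
Proof.
rewrite -[X in measurable X]setTI.
rewrite (_ : [set p | _] =
  (fun p : E * E => euclidean_dist p.1 p.2) @^-1` `]-oo, l[); last first.
  by apply/seteqP; split => p /=; rewrite in_itv.
exact: measurable_euclidean_dist.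
Qed.

Lemma measurable_diag : measurable [set p : E * E | p.1 = p.2].
Proof.
rewrite (_ : [set p | _] = \bigcap_(i in [set: 'I_d])
    [set p : E * E | p.1 ord0 i - p.2 ord0 i = 0]).
  apply: fin_bigcap_measurable; first exact: finite_finset.
  move=> i _; rewrite -[X in measurable X]setTI.
  suff m : measurable_fun setT (fun p : E * E => p.1 ord0 i - p.2 ord0 i).
    exact: (m measurableT [set 0]).
  apply: (measurable_funB (f := fun p : E * E => p.1 ord0 i)
                          (g := fun p : E * E => p.2 ord0 i)).
    exact: (measurableT_comp (measurable_coord i) measurable_fst).
  exact: (measurableT_comp (measurable_coord i) measurable_snd).
apply/seteqP; split => -[x y] /= => [-> i _|xy]; first by rewrite /= subrr.
by apply/rowP => i; apply/eqP; rewrite -subr_eq0; apply/eqP; exact: xy.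
Qed.

Lemma num_points_gt0 (A : set E) (X : config) :
  (0 < num_points A X)%N <-> exists2 x, x \in X & A x.
Proof.
rewrite /num_points cardfs_gt0; split.
  by move=> /fset0Pn[x]; rewrite !inE/= => /andP[xX /set_mem Ax]; exists x.
move=> [x xX Ax]; apply/fset0Pn; exists x; rewrite !inE/= xX/=.
exact: mem_set.
Qed.

Lemma measurable_exists_point dT (T : measurableType dT) (C : set (T * E)) :
  measurable C ->
  measurable [set p : T * config | exists2 y, y \in p.2 & C (p.1, y)].
Proof.
move=> mC; have := measurable_num_points_section mC measurableT
  (measurable_itv `]0, +oo[).
rewrite setTI; congr measurable; apply/seteqP; split => p /=;
  by rewrite in_itv/= andbT ltr0n num_points_gt0.
Qed.

Lemma measurable_packings r D : measurable D -> measurable (packings r D).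
Proof.
move=> mD.
pose bad := [set p : E * E | p.1 <> p.2] `&`
            [set p : E * E | euclidean_dist p.1 p.2 < 2 * r].
have mbad : measurable bad.
  apply: measurableI; last exact: measurable_close.
  exact: (measurableC measurable_diag).
have mb1 : measurable [set p : config * E | exists2 y, y \in p.1 & bad (p.2, y)].
  have m := measurable_exists_point mbad.
  have := @measurable_swap _ _ config E measurableT _ m.
  by rewrite setTI.
have mb2 : measurable [set p : config * config |
    exists2 x, x \in p.2 & exists2 y, y \in p.1 & bad (x, y)].
  exact: (measurable_exists_point mb1).
have mb3 : measurable [set X : config |
    exists2 x, x \in X & exists2 y, y \in X & bad (x, y)].
  have mdup : measurable_fun setT (fun X : config => (X, X)).
    exact: measurable_fun_pair.
  by have := mdup measurableT _ mb2; rewrite setTI.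
have mout : measurable [set X : config | (0 < num_points (~` D) X)%N].
  have := measurable_num_points (measurableC mD) measurableT
    (measurable_itv `]0, +oo[).
  rewrite setTI; congr measurable; apply/seteqP; split => p /=;
    by rewrite in_itv/= andbT ltr0n.
rewrite (_ : packings r D = ~` [set X : config | (0 < num_points (~` D) X)%N] `&`
   ~` [set X : config |
    exists2 x, x \in X & exists2 y, y \in X & bad (x, y)]).
  by apply: measurableI; exact: measurableC.
apply/seteqP; split => X [XD Xr]; split.
- by move=> /= /num_points_gt0[x /XD Dx]; exact.
- move=> /= [x xX [y yX [/= xy]]]; apply/negP; rewrite -leNgt.
  by apply: Xr => //; exact/eqP.
- move=> x xX; apply: contrapT => Dx; apply: XD; apply/num_points_gt0.
  by exists x.
- move=> x y xX yX xy; rewrite leNgt; apply/negP => xyr; apply: Xr.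
  by exists x => //; exists y => //; split => //=; exact/eqP.
Qed.

Lemma measurable_hard_core r : measurable [set X : config | hard_core r X].
Proof.
rewrite (_ : [set X | _] = packings r setT); first exact: measurable_packings.
by apply/seteqP; split => X //= [].
Qed.

Lemma measurable_restrict_config (A : set E) : measurable A ->
  measurable_fun setT (restrict_config A).
Proof.
move=> mA; apply: measurable_config_fun => B mB.
rewrite (_ : (fun t => _) = (fun X => (num_points (A `&` B) X)%:R)).
  by apply: measurable_num_points; exact: measurableI.
apply/funext => X; congr (_%:R); rewrite /num_points; congr (#|` _|).
by apply/fsetP => x; rewrite !inE/= -andbA; congr andb; rewrite in_setI.
Qed.

Lemma measurable_insert_center : measurable_fun setT insert_center.
Proof.
apply: measurable_config_fun => A mA.
pose C := [set p : E * E | p.1 = p.2] `&` (setT `*` A).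
have mC : measurable C.
  by apply: measurableI; [exact: measurable_diag|exact: measurableX].
have m := @measurable_num_points_section _ E C mC.
have mns : measurable_fun setT (fun p : config * E => (p.2, p.1)).
  exact: measurable_swap.
rewrite (_ : (fun t => _) = (fun p : config * E =>
    (num_points A p.1)%:R + \1_A p.2 -
    (num_points [set y | C (p.2, y)] p.1)%:R)).
  apply: measurable_funB; last exact: (measurableT_comp m mns).
  apply: measurable_funD.
    exact: (measurableT_comp (measurable_num_points mA) measurable_fst).
  exact: (measurableT_comp (@measurable_indic _ _ _ _ A mA) measurable_snd).
apply/funext => -[X x]; rewrite !num_pointsE /insert_center/=.
have [xX|xX] := boolP (x \in X).
  rewrite mem_fset1U// -[LHS]addr0 -addrA; congr (_ + _); apply/esym/eqP.
  rewrite subr_eq0; apply/eqP; rewrite (big_fsetD1 x)//= [X in _ + X]big1_seq.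
    rewrite addr0 !indicE; congr (_%:R); congr (nat_of_bool _).
    by apply/idP/idP => /set_mem h; apply/mem_set; [split|case: h => _ []].
  move=> y /andP[_]; rewrite !inE => /andP[/eqP yx _]; rewrite indicE memNset//.
  by case=> /= xy; case: yx.
rewrite big_fsetU1//= addrC -[LHS]subr0; congr (_ - _); apply/esym.
rewrite big1_seq// => y /andP[_ yX]; rewrite indicE memNset//.
by case=> /= xy; move: xX; rewrite xy yX.
Qed.

Lemma measurable_delete_ball r : measurable_fun setT (delete_ball r).
Proof.
apply: measurable_config_fun => A mA.
pose C := ~` [set p : E * E | euclidean_dist p.1 p.2 < r] `&` (setT `*` A).
have mC : measurable C.
  apply: measurableI; last exact: measurableX.
  exact: (measurableC (measurable_close r)).
have m := @measurable_num_points_section _ E C mC.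
have mns : measurable_fun setT (fun p : config * E => (p.2, p.1)).
  exact: measurable_swap.
rewrite (_ : (fun t => _) = (fun p : config * E =>
    (num_points [set y | C (p.2, y)] p.1)%:R)).
  exact: (measurableT_comp m mns).
apply/funext => -[X x]; congr (_%:R); rewrite /num_points; congr (#|` _|).
apply/fsetP => y; rewrite !inE/= -andbA; congr andb.
apply/andP/idP => [[/negP yb /set_mem Ay]|/set_mem[yb [_ Ay]]].
  apply/mem_set; split; last by split.
  by move=> h; apply: yb; exact: mem_set.
by split; [apply/negP => /set_mem; exact: yb|exact: mem_set].
Qed.

Lemma measurable_config_of_tuple k : measurable_fun setT (@config_of_tuple k).
Proof.
elim: k => [|k ih].
  rewrite (_ : @config_of_tuple 0 = cst fset0); first exact: measurable_cst.
  by apply/funext => t; rewrite tuple0; apply/fsetP => x; rewrite !inE.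
rewrite (_ : @config_of_tuple k.+1 = insert_center \o
  (fun t => (config_of_tuple (tuncons t).2, (tuncons t).1))).
  apply: measurableT_comp; first exact: measurable_insert_center.
  have m := @measurable_tuncons _ E k.
  apply: measurable_fun_pair; last exact: (measurableT_comp measurable_fst m).
  exact: (measurableT_comp ih (measurableT_comp measurable_snd m)).
apply/funext => t; apply/fsetP => x; rewrite [in LHS](tuple_eta t).
by rewrite /insert_center /config_of_tuple !inE.
Qed.

End configurations.

Section hard_sphere_model.
Context (R : realType) (d : nat).
Local Notation E := 'rV[R]_d.
Local Notation config := (config R d).

Record region := Region {
  region_set :> set E ;
  region_compact : compact region_set ;
  region_measurable : measurable region_set }.

Record boundary_condition (r : R) (L : region) := BoundaryCondition {
  forbidden :> set E ;
  forbidden_measurable : measurable forbidden ;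
  forbidden_sub : forbidden `<=` r_interior r L }.

Section poisson.
Variables (lam : {posnum R}) (D : set E) (mD : measurable D).

Section points.
Variable k : nat.
Definition points_law : set config -> \bar R :=
  pushforward (power_measure (smrestr (@lebesgue_rV R d) mD) k)
    (@config_of_tuple R d k).

HB.instance Definition _ := isMeasurableFun.Build _ _ _ _
  (@config_of_tuple R d k) (@measurable_config_of_tuple R d k).

Let points_law0 : points_law set0 = 0%E.
Proof. by rewrite /points_law /pushforward preimage_set0 measure0. Qed.

Let points_law_ge0 A : (0 <= points_law A)%E.
Proof. by rewrite /points_law /pushforward measure_ge0. Qed.

Let points_law_sigma_additive : semi_sigma_additive points_law.
Proof.
exact: (@measure_semi_sigma_additive _ _ _
  (pushforward (power_measure (smrestr (@lebesgue_rV R d) mD) k)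
    (@config_of_tuple R d k))).
Qed.

HB.instance Definition _ := isMeasure.Build _ _ _ points_law
  points_law0 points_law_ge0 points_law_sigma_additive.
End points.

Lemma poisson_weight_ge0 k :
  0 <= expR (- (lam%:num * fine (lebesgue_rV D))) * lam%:num ^+ k / k`!%:R.
Proof. by rewrite divr_ge0// mulr_ge0// expR_ge0. Qed.

(* For D of finite volume: the law of N i.i.d. uniform points of D, where N is
   Poisson with mean lam |D|, that is
     P(A) = \sum_k exp(- lam |D|) lam^k / k! *
            |{(x_1, ..., x_k) in D^k : {x_1, ..., x_k} in A}|. *)
Definition poisson_process : {measure set config -> \bar R} :=
  mseries (fun k => mscale (NngNum (poisson_weight_ge0 k)) (points_law k)) 0.

End poisson.

Definition centers (r : R) (L : region) (t : boundary_condition r L) : set E :=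
  r_interior r L `\` t.

Lemma measurable_centers r L (t : boundary_condition r L) :
  measurable (centers t).
Proof.
apply: measurableD; last exact: forbidden_measurable.
by apply: measurable_r_interior; exact: region_measurable.
Qed.

(* Conditioning on the hard-core event. The default measure of [mnormalize] plays
   no role: the event has mass at least exp(- lam |D|) > 0, because of the empty
   configuration, and at most 1. *)
Definition hard_sphere (lam : {posnum R}) (r : R) (L : region)
    (t : boundary_condition r L) : probability config R :=
  mnormalize (mrestr (poisson_process lam (measurable_centers t))
                     (@measurable_hard_core R d r)) (\d_(fset0 : config)).

Definition tv_dist dT (T : measurableType dT) (mu nu : set T -> \bar R) :
    \bar R :=
  ereal_sup [set `|mu A - nu A|%E | A in measurable].

Definition tv_dist_on (r : R) (L' : region) (mu nu : set config -> \bar R) :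
    \bar R :=
  tv_dist (pushforward mu (restrict_config (r_interior r L')))
          (pushforward nu (restrict_config (r_interior r L'))).

(* [expeR -oo = 0], so the bound is 0 when t = t'. *)
Definition strong_spatial_mixing (lam : {posnum R}) (r : R) : Prop :=
  exists alpha beta : R, [/\ 0 < alpha, 0 < beta &
    forall (L' L : region), L' `<=` L ->
    forall t t' : boundary_condition r L,
      (tv_dist_on r L' (hard_sphere lam t) (hard_sphere lam t') <=
       beta%:E * lebesgue_rV L' * expeR (- (alpha%:E * set_dist (t `+` t') L')))%E].

(* Only used for L of positive volume, so that the default measure of
   [mnormalize] is irrelevant. *)
Definition uniform_on (L : region) : probability E R :=
  mnormalize (mrestr (@lebesgue_rV R d) (region_measurable L)) (\d_(0 : E)).

(* The random input of one step: the location, and a coin telling whether to add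
   a center there ([true]) or to delete the centers around it. *)
Definition update_choice (lam : {posnum R}) (L : region) :
    probability (E * bool)%type R :=
  (uniform_on L \x bernoulli_prob (lam%:num / (1 + lam%:num)))%E.

Section step.
Variables (r : R) (L : region) (t : boundary_condition r L).

Definition single_center_step (p : config * (E * bool)) : config :=
  let: (X, (x, add)) := p in
  if add then
    let X' := insert_center (X, x) in
    if X' \in packings r (centers t) then X' else X
  else delete_ball r (X, x).

Lemma measurable_single_center_step : measurable_fun setT single_center_step.
Proof.
have mX : measurable_fun setT (fun p : config * (E * bool) => p.1).
  exact: measurable_fst.
have mx : measurable_fun setT (fun p : config * (E * bool) => (p.1, p.2.1)).
  apply: measurable_fun_pair => //.
  exact: (measurableT_comp measurable_fst measurable_snd).
have mi := measurableT_comp (@measurable_insert_center R d) mx.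
have mb : measurable_fun setT (fun p : config * (E * bool) => p.2.2).
  exact: (measurableT_comp measurable_snd measurable_snd).
rewrite (_ : single_center_step = fun p => if p.2.2 then
    if insert_center (p.1, p.2.1) \in packings r (centers t)
    then insert_center (p.1, p.2.1) else p.1
    else delete_ball r (p.1, p.2.1)); last by apply/funext => -[X [x []]].
apply: measurable_fun_ifT => //; last first.
  exact: (measurableT_comp (@measurable_delete_ball R d r) mx).
apply: measurable_fun_ifT => //; apply: (measurable_fun_bool true).
rewrite (_ : _ @^-1` _ =
  (fun p : config * (E * bool) => insert_center (p.1, p.2.1)) @^-1`
    packings r (centers t)).
  have mp := @measurable_packings R d r _ (measurable_centers t).
  by have := mi measurableT _ mp; rewrite setTI.
by apply/seteqP; split => p /=; [exact: set_mem|exact: mem_set].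
Qed.

HB.instance Definition _ := isMeasurableFun.Build _ _ _ _ single_center_step
  measurable_single_center_step.

(* The law of X_{t+1} when X_t has law mu, the random input of the step being
   independent of X_t. *)
Definition next_law (lam : {posnum R}) (mu : probability config R) :
    probability config R :=
  distribution (mu \x update_choice lam L)%E single_center_step.

Definition law_at (lam : {posnum R}) (mu0 : probability config R) (n : nat) :
    probability config R :=
  iter n (next_law lam) mu0.

End step.

Definition optimal_temporal_mixing (lam : {posnum R}) (r : R) : Prop :=
  exists b c : R, [/\ 0 < b, 0 < c &
    forall L : region, (0 < lebesgue_rV L)%E ->
    forall (t : boundary_condition r L) (s : R), 0 < s ->
    forall mu0 nu0 : probability config R,
      mu0 (packings r (centers t)) = 1%E ->
      nu0 (packings r (centers t)) = 1%E ->
      let n := fine (lebesgue_rV L) in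
      (tv_dist (law_at t lam mu0 (Num.truncn (s * n)))
               (law_at t lam nu0 (Num.truncn (s * n))) <=
       (b * n * expR (- (c * s)))%:E)%E].

End hard_sphere_model.

(* Main.v *)
(* Both Gibbs measures are compared with one and the same single-center dynamics
   on a window L1 around L' of volume n = O(|L'| rho^d), where rho is of the order
   of dist(t + t', L'). The measure mu_L^t is stationary for the dynamics on L
   whose updates are restricted to a region N inside the window (detailed balance,
   in the form of the Mecke identity), so no conditioning on the configuration
   outside the window is needed. Run this restricted dynamics from mu_L^t, coupled
   by common updates with the single-center dynamics on the window started from
   the trace on N. A discrepancy between the two is only created within 2r of
   another one, hence the expected number of discrepancies around L' stays below
   2n exp(-K)(1 + e V / n)^m after m steps, K = O(rho) being the number of layers
   of width 2r between L' and the boundary of N and V a bound on the volume of a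
   ball of radius 2r. As t and t' agree on N, both boundary conditions lead to the
   same dynamics on the window, started from two different laws, and optimal
   temporal mixing bounds the distance of the latter at time m = floor(s n);
   s is a small multiple of rho. *)
Require Import Defs.
From HB Require Import structures.
From mathcomp Require Import all_boot all_order all_algebra.
From mathcomp Require Import finmap.
From mathcomp Require Import all_classical all_reals all_analysis measurable_realfun.
From mathcomp Require Import lra.

Set Implicit Arguments.
Unset Strict Implicit.
Unset Printing Implicit Defensive.

Import Order.TTheory GRing.Theory Num.Theory.
Import numFieldNormedType.Exports.

Local Open Scope classical_set_scope.
Local Open Scope ring_scope.

(** * The Euclidean metric *)

(** Temporal mixing gives an error proportional to the volume on which the chain runs, whereas the
    spatial bound may involve only |L'|, however large L is: hence the window. Its volume has to be
    controlled by |L'|, which fails for a neighbourhood of a thin L'. But only L'_Int matters, and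
    it is covered by balls of radius 2r around a maximal packing, which has at most |L'| points, the
    balls of volume 1 around them being disjoint subsets of L'.

    Centers outside N stay frozen in the restricted dynamics and block insertions near the border of
    N, which the window chain does not see. Discrepancies enter there, and for the outermost layer
    only the packing bound is available. They travel at bounded speed: with s = K / (2 e V) the
    coupling error is of order n e^(-K + e V s) = n e^(-K/2), the mixing error of order n e^(-c s),
    and both decay exponentially in K. The factor K^d hidden in n costs half of the rate. If L'_Int
    is nonempty then |L'| >= 1, so small distances are settled by the trivial bound 1. *)

Section euclidean_metric.
Context (R : realType) (d : nat).
Local Notation E := 'rV[R]_d.
Implicit Types x y z : E.

Lemma euclidean_dist_ge0 x y : 0 <= euclidean_dist x y.
Proof. exact: sqrtr_ge0. Qed.

Lemma euclidean_distC x y : euclidean_dist x y = euclidean_dist y x.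
Proof.
by congr Num.sqrt; apply: eq_bigr => i _; rewrite -opprB sqrrN.
Qed.

Lemma euclidean_distxx x : euclidean_dist x x = 0.
Proof.
by rewrite /euclidean_dist big1 ?sqrtr0// => i _; rewrite subrr expr0n.
Qed.

(** The squares [(B * a i - S * b i) ^+ 2] sum to [B * (A * B - S ^+ 2)]; divide by [B], or note
    that [B = 0] makes every [b i] vanish. *)
Lemma sum_cauchy_schwarz (a b : 'I_d -> R) :
  (\sum_i a i * b i) ^+ 2 <= (\sum_i a i ^+ 2) * (\sum_i b i ^+ 2).
Proof.
set S := \sum_i a i * b i; set A := \sum_i a i ^+ 2; set B := \sum_i b i ^+ 2.
have B0 : 0 <= B by apply: sumr_ge0 => i _; exact: sqr_ge0.
have : 0 <= \sum_i (B * a i - S * b i) ^+ 2.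
  by apply: sumr_ge0 => i _; exact: sqr_ge0.
have -> : \sum_i (B * a i - S * b i) ^+ 2 = B * (A * B - S ^+ 2).
  under eq_bigr => i _.
    rewrite (_ : _ ^+ 2 = B ^+ 2 * a i ^+ 2 + (- (2 * B * S)) * (a i * b i)
      + S ^+ 2 * b i ^+ 2); last by clearbody A B S; lra.
  over.
  rewrite !big_split/= -!mulr_sumr -/A -/B -/S; clearbody A B S; lra.
have [B_gt0|] := ltP 0 B; first by rewrite pmulr_rge0// subr_ge0.
move=> Ble0 _; have /eqP B00 : B == 0 by rewrite eq_le Ble0.
have b0 i : b i = 0.
  apply/eqP; rewrite -sqrf_eq0; move/eqP: B00.
  rewrite /B psumr_eq0 => [/allP/(_ i)|j _]; last exact: sqr_ge0.
  by rewrite mem_index_enum => /(_ isT).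
by rewrite /S big1 ?expr0n/= ?B00 ?mulr0// => i _; rewrite b0 mulr0.
Qed.

Lemma euclidean_dist_triangle y x z :
  euclidean_dist x z <= euclidean_dist x y + euclidean_dist y z.
Proof.
rewrite /euclidean_dist; set A := (X in _ <= Num.sqrt X + _).
set B := (X in _ <= _ + Num.sqrt X).
have A0 : 0 <= A by apply: sumr_ge0 => i _; exact: sqr_ge0.
have B0 : 0 <= B by apply: sumr_ge0 => i _; exact: sqr_ge0.
rewrite -[leRHS]ger0_norm ?addr_ge0 ?sqrtr_ge0//.
rewrite -sqrtr_sqr ler_sqrt ?sqr_ge0// sqrrD !sqr_sqrtr//.
rewrite (_ : \sum_i _ = A + (\sum_i (x ord0 i - y ord0 i) * (y ord0 i - z ord0 i)) *+ 2 + B); last first.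
  rewrite /A /B -mulr_natl mulr_sumr -!big_split/=; apply: eq_bigr => i _; lra.
rewrite lerD2r lerD2l ler_wMn2r//; apply: le_trans (ler_norm _) _.
rewrite -sqrtrM// -sqrtr_sqr ler_sqrt; last exact: mulr_ge0.
exact: sum_cauchy_schwarz.
Qed.

Lemma euclidean_distD (a x y : E) :
  euclidean_dist (x + a) (y + a) = euclidean_dist x y.
Proof.
congr Num.sqrt; apply: eq_bigr => i _.
by rewrite !mxE opprD addrACA subrr addr0.
Qed.

Lemma coord_le_euclidean_dist x y i :
  `|x ord0 i - y ord0 i| <= euclidean_dist x y.
Proof.
rewrite -sqrtr_sqr ler_sqrt; last by apply: sumr_ge0 => j _; exact: sqr_ge0.
by rewrite (bigD1 i)//= lerDl; apply: sumr_ge0 => j _; exact: sqr_ge0.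
Qed.

Lemma euclidean_ball_sym x y l : euclidean_ball x l y <-> euclidean_ball y l x.
Proof. by rewrite /euclidean_ball/= euclidean_distC. Qed.

Lemma open_euclidean_ball x l : open (euclidean_ball x l).
Proof.
rewrite (_ : euclidean_ball x l = (fun y => euclidean_dist y x) @^-1` [set t | t < l]).
  apply: open_comp; last exact: open_lt.
  by move=> y _; exact: euclidean_dist_continuous.
by apply/seteqP; split => y; rewrite /euclidean_ball/= euclidean_distC.
Qed.

Lemma measurable_euclidean_ball x l : measurable (euclidean_ball x l).
Proof. apply: open_measurable_rV; exact: open_euclidean_ball. Qed.

End euclidean_metric.

Lemma integral_indicT d (T : measurableType d) (R : realType)
    (mu : {measure set T -> \bar R}) (A : set T) : measurable A ->
  (\int[mu]_x (\1_A x)%:E = mu A)%E.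
Proof. by move=> mA; rewrite integral_indic// setIT. Qed.

(** * Integrals over powers of a measure *)

Section power_measure_integral.
Context d (T : measurableType d) (R : realType).
Local Open Scope ereal_scope.

Lemma ge0_integral_power_measureS (mu : {sigma_finite_measure set T -> \bar R})
    (n : nat) (f : n.+1.-tuple T -> \bar R) :
  measurable_fun setT f -> (forall t, 0 <= f t) ->
  \int[power_measure mu n.+1]_t f t =
  \int[mu]_x \int[power_measure mu n]_t f (tcons (x, t)).
Proof.
move=> mf f0; rewrite /= /cons_measure.
rewrite (ge0_integral_pushforward (@measurable_tcons _ T n))//.
rewrite preimage_setT fubini_tonelli1//=.
  exact: (measurableT_comp mf (@measurable_tcons _ T n)).
Qed.

Lemma ge0_measurable_fun_power_measure
    (mu : {sigma_finite_measure set T -> \bar R})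
    (n : nat) (f : n.+1.-tuple T -> \bar R) :
  measurable_fun setT f -> (forall t, 0 <= f t) ->
  measurable_fun setT (fun x => \int[power_measure mu n]_t f (tcons (x, t))).
Proof.
move=> mf f0.
apply: (measurable_fun_fubini_tonelli_F (f \o @tcons _ T n)) => //.
  exact: (measurableT_comp mf (@measurable_tcons _ T n)).
by move=> t /=.
Qed.

End power_measure_integral.

(** * Lebesgue measure on row vectors *)

Section lebesgue_translation.
Context (R : realType).
Local Open Scope ereal_scope.
Local Notation mu := (@lebesgue_measure R).
Local Notation mR := (measurableTypeR R).

Lemma measurable_translation (a : R) :
  measurable_fun setT (fun x : mR => (x + a)%R : mR).
Proof.
by apply: (measurable_funD (f := fun x : mR => x : R) (g := cst a)).
Qed.

(** The pushforward gives half-open intervals their length, and this determines Lebesgue measure. *)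
Lemma lebesgue_measure_translation (a : R) (A : set mR) : measurable A ->
  pushforward mu (fun x : mR => (x + a)%R : mR) A = mu A.
Proof.
pose phi := (fun x : mR => (x + a)%R : mR).
pose mixin := isMeasurableFun.Build _ _ _ _ phi (measurable_translation a).
pose pphi : {mfun mR >-> mR} := HB.pack phi mixin.
move=> mA; apply/esym.
apply: (@lebesgue_measure_unique R (pushforward mu pphi)) => //= _ [[x y]] _ <-.
rewrite /pushforward (_ : _ @^-1` _ = `]x - a, y - a]%classic)%R.
  by rewrite !lebesgue_measure_itv/= !lte_fin ltrD2r; case: ifP => // _;
    rewrite -!EFinB; congr (_%:E); lra.
by apply/seteqP; split => z /=; rewrite !in_itv/= /phi lerBrDr ltrBlDr.
Qed.

Lemma ge0_integral_translation (a : R) (f : mR -> \bar R) :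
  measurable_fun setT f -> (forall x, 0 <= f x) ->
  \int[mu]_x f (x + a)%R = \int[mu]_x f x.
Proof.
move=> mf f0; transitivity (\int[pushforward mu (fun x : mR => (x + a)%R : mR)]_x f x).
  by rewrite (ge0_integral_pushforward (measurable_translation a))// preimage_setT.
pose phi := (fun x : mR => (x + a)%R : mR).
pose mixin := isMeasurableFun.Build _ _ _ _ phi (measurable_translation a).
pose pphi : {mfun mR >-> mR} := HB.pack phi mixin.
apply: (@eq_measure_integral _ _ _ _ (mu : {measure set mR -> \bar R}) (pushforward mu pphi)).
by move=> A mA _; exact: lebesgue_measure_translation.
Qed.

Definition tuple_translation n (a t : n.-tuple mR) : n.-tuple mR :=
  [tuple (tnth t i + tnth a i)%R | i < n].

Lemma measurable_tuple_translation n (a : n.-tuple mR) :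
  measurable_fun setT (tuple_translation a).
Proof.
apply/measurable_fun_tnthP => i.
rewrite (_ : _ \o _ = fun t => (tnth t i + tnth a i)%R : mR); last first.
  by apply/funext => t /=; rewrite tnth_mktuple.
exact: (measurableT_comp (measurable_translation _) (@measurable_tnth _ _ _ i)).
Qed.

(** Induction on the dimension: one-dimensional invariance handles the first coordinate, the
    induction hypothesis the others. *)
Lemma ge0_integral_tuple_translation n (a : n.-tuple mR) (f : n.-tuple mR -> \bar R) :
  measurable_fun setT f -> (forall x, 0 <= f x) ->
  \int[power_measure mu n]_t f (tuple_translation a t) =
  \int[power_measure mu n]_t f t.
Proof.
elim: n a f => [|n ih] a f mf f0.
  by apply: eq_integral => t _; rewrite (tuple0 (tuple_translation a t)) (tuple0 t).
have mc : measurable_fun setT (f \o @tcons _ mR n).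
  exact: (measurableT_comp mf (@measurable_tcons _ mR n)).
have mfa : measurable_fun setT (fun t => f (tuple_translation a t)).
  exact: (measurableT_comp mf (measurable_tuple_translation a)).
rewrite (ge0_integral_power_measureS mu mfa (fun t => f0 (tuple_translation a t))).
rewrite (ge0_integral_power_measureS mu mf f0).
have mF := ge0_measurable_fun_power_measure mu mf f0.
rewrite -(@ge0_integral_translation (thead a) _ mF); last first.
  by move=> x; apply: integral_ge0.
apply: eq_integral => x _.
rewrite -(ih [tuple of behead a] (fun t => f (tcons ((x + thead a)%R : mR, t))))//; last first.
  exact: (measurableT_comp mc (pair1_measurable ((x + thead a)%R : mR))).
apply: eq_integral => t _; congr f.
apply: eq_from_tnth => i; rewrite tnth_mktuple.
case: (unliftP ord0 i) => [j ->|->].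
  by rewrite !tnthS/= !tnth_mktuple; congr (_ + _)%R; rewrite tnth_behead; congr tnth; apply: val_inj; rewrite /= inordK// ltnS.
by rewrite !tnth0/= /thead.
Qed.

Lemma power_lebesgue_cube n (w : R) : (0 <= w)%R ->
  power_measure mu n [set t | forall i, `|tnth t i| <= w]%R =
    ((2 * w) ^+ n)%:E.
Proof.
move=> w0; elim: n => [|n ih].
  by rewrite /= diracE mem_set// => -[].
rewrite /= /cons_measure /pushforward.
rewrite (_ : _ @^-1` _ = `[(- w)%R, w]%classic `*`
    [set t : n.-tuple mR | forall i, `|tnth t i| <= w]%R); last first.
  apply/seteqP; split => [[x t] /= h|[x t] /= [hx ht] i].
    split; first by have := h ord0; rewrite tnth0 in_itv/= ler_norml.
    by move=> i; have := h (lift ord0 i); rewrite tnthS.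
  case: (unliftP ord0 i) => [j ->|->]; first by rewrite tnthS; exact: ht.
  by rewrite tnth0 ler_norml; move: hx; rewrite in_itv.
rewrite product_measure1E//; last first.
  rewrite (_ : [set t | _] = \bigcap_(i in [set: 'I_n])
      [set t : n.-tuple mR | `|tnth t i| <= w]%R); last first.
    by apply/seteqP; split => [t h i _|t h i]; [exact: h|exact: (h i)].
  apply: fin_bigcap_measurable; first exact: finite_finset.
  move=> i _; rewrite -[X in measurable X]setTI.
  rewrite (_ : [set t | _] = (fun t : n.-tuple mR => tnth t i) @^-1` `[(- w)%R, w]%classic).
    exact: measurable_tnth.
  by apply/seteqP; split => t /=; rewrite in_itv/= ler_norml.
rewrite [X in _ * X](_ : _ = ((2 * w) ^+ n)%:E) ?ih//.
rewrite [X in X * _](_ : _ = (2 * w)%:E) ?exprS//.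
transitivity (lebesgue_measure (`[(- w)%R, w]%classic : set R)) => //.
rewrite lebesgue_measure_itv/= lte_fin opprK; case: ltP => h.
  by rewrite -EFinD mulr_natl mulr2n.
by have -> : w = 0%R; [lra|rewrite mulr0].
Qed.

End lebesgue_translation.

Section lebesgue_rV_lemmas.
Context (R : realType) (d : nat).
Local Notation E := 'rV[R]_d.
Local Open Scope ereal_scope.

Lemma lebesgue_rV_translation (a : E) (A : set E) : measurable A ->
  lebesgue_rV [set x | A (x + a)%R] = lebesgue_rV A.
Proof.
move=> mA; rewrite /lebesgue_rV /pushforward.
set B : set (d.-tuple (measurableTypeR R)) := @row_of_tuple R d @^-1` A.
have mB : measurable B.
  by rewrite -[X in measurable X]setTI; exact: measurable_row_of_tuple.
have mT : measurable (tuple_translation (tuple_of_row a) @^-1` B).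
  by rewrite -[X in measurable X]setTI; exact: measurable_tuple_translation.
have := @ge0_integral_tuple_translation R d (tuple_of_row a) (EFin \o \1_B).
case/(_ _ _)/Wrap => [|x|].
- by apply/measurable_EFinP; exact: measurable_indic.
- by rewrite lee_fin.
move=> Bshift.
have rowE t : row_of_tuple (tuple_translation (tuple_of_row a) t) = (row_of_tuple t + a)%R.
  by apply/rowP => i; rewrite !mxE tnth_mktuple tnth_mktuple.
transitivity (power_measure (@lebesgue_measure R) d (tuple_translation (tuple_of_row a) @^-1` B)).
  by congr (power_measure _ _ _); apply/seteqP; split => t; rewrite /B /= rowE.
transitivity (\int[power_measure (@lebesgue_measure R) d]_t
    (\1_(tuple_translation (tuple_of_row a) @^-1` B) t)%:E).
  by rewrite integral_indic// setIT.
transitivity (\int[power_measure (@lebesgue_measure R) d]_t (\1_B t)%:E) => //.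
by rewrite integral_indic// setIT.
Qed.

Lemma lebesgue_euclidean_ball (x : E) (l : R) :
  lebesgue_rV (euclidean_ball x l) = lebesgue_rV (euclidean_ball (0 : E)%R l).
Proof.
rewrite -(lebesgue_rV_translation x (measurable_euclidean_ball x l)).
congr lebesgue_rV; apply/seteqP; split => y; rewrite /euclidean_ball/=;
  by rewrite -(euclidean_distD x 0%R) add0r.
Qed.

Lemma measurable_cube (x : E) (w : R) :
  measurable [set y : E | forall i, `|y ord0 i - x ord0 i| <= w]%R.
Proof.
rewrite (_ : [set y | _] = \bigcap_(i in [set: 'I_d])
    [set y : E | `|y ord0 i - x ord0 i| <= w]%R); last first.
  by apply/seteqP; split => [t h i _|t h i]; [exact: h|exact: (h i)].
apply: fin_bigcap_measurable; first exact: finite_finset.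
move=> i _; apply: closed_measurable_rV.
apply: (@closed_comp _ _ (fun y : E => `|y ord0 i - x ord0 i|%R) [set t | (t <= w)%R]).
  move=> y _; apply: (@continuous_comp _ _ _ (fun y : E => y ord0 i - x ord0 i)%R
    (fun t : R => `|t|%R)); last exact: norm_continuous.
  by apply: continuousB; [exact: coord_continuous|exact: cst_continuous].
exact: closed_le.
Qed.

Lemma lebesgue_rV_cube (x : E) (w : R) : (0 <= w)%R ->
  lebesgue_rV [set y : E | forall i, `|y ord0 i - x ord0 i| <= w]%R =
  ((2 * w) ^+ d)%:E.
Proof.
move=> w0; rewrite -power_lebesgue_cube// -(lebesgue_rV_translation x).
  congr (power_measure _ _ _); apply/seteqP; split => t /= + i => /(_ i);
  by rewrite !mxE addrK.
exact: measurable_cube.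
Qed.

Definition closed_euclidean_ball (x : E) (l : R) : set E :=
  [set y | euclidean_dist x y <= l]%R.

Lemma closed_closed_euclidean_ball x l : closed (closed_euclidean_ball x l).
Proof.
rewrite (_ : closed_euclidean_ball x l = (fun y => euclidean_dist y x) @^-1` [set t | t <= l]%R).
  apply: closed_comp; last exact: closed_le.
  by move=> y _; exact: euclidean_dist_continuous.
by apply/seteqP; split => y; rewrite /closed_euclidean_ball/= euclidean_distC.
Qed.

(** The circumscribed cube suffices: in the later bounds only the power [l ^+ d] matters, not the
    constant. *)
Lemma lebesgue_closed_euclidean_ball_le x l : (0 <= l)%R ->
  lebesgue_rV (closed_euclidean_ball x l) <= ((2 * l) ^+ d)%:E.
Proof.
move=> l0; rewrite -(lebesgue_rV_cube x l0); apply: le_measure; rewrite ?inE.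
- by apply: closed_measurable_rV; exact: closed_closed_euclidean_ball.
- exact: measurable_cube.
move=> y /= yl i; apply: le_trans yl; rewrite euclidean_distC.
exact: coord_le_euclidean_dist.
Qed.

(** A point is the cube of half-side 0. Positivity of [d] enters because the space of dimension 0 is
    a single point of mass 1. *)
Lemma lebesgue_rV_set1 (x : E) : (0 < d)%N -> lebesgue_rV [set x] = 0.
Proof.
move=> d0; rewrite (_ : [set x] = [set y : E | forall i, `|y ord0 i - x ord0 i| <= 0]%R).
  by rewrite lebesgue_rV_cube// mulr0 expr0n; case: d d0.
apply/seteqP; split => [y -> i|y h]; first by rewrite subrr normr0.
by apply/rowP => i; apply/eqP; rewrite -subr_eq0 -normr_le0; exact: h.
Qed.

Lemma lebesgue_rV_compact_lty (A : set E) : compact A -> measurable A ->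
  lebesgue_rV A < +oo.
Proof.
move=> /compact_bounded[M [_ /(_ (`|M| + 1)%R)]] + mA.
have M1 : (M < `|M| + 1)%R by rewrite (le_lt_trans (ler_norm M))// ltrDl.
move=> /(_ M1) AM; have M0 : (0 <= `|M| + 1)%R by rewrite addr_ge0.
apply: (@le_lt_trans _ _ (lebesgue_rV [set y : E | forall i, `|y ord0 i - (0 : E)%R ord0 i| <= `|M| + 1]%R)).
  apply: le_measure; rewrite ?inE//; first exact: measurable_cube.
  move=> y /AM /= yM i; apply: le_trans yM; rewrite mxE subr0.
  rewrite [leRHS]/Num.norm /= mx_normrE; apply/bigmax_geP; right => /=.
  by exists (ord0, i).
by rewrite lebesgue_rV_cube// ltry.
Qed.

End lebesgue_rV_lemmas.

(** * Packings *)

Section packing.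
Context (R : realType) (d : nat) (r : R).
Local Notation E := 'rV[R]_d.
Hypothesis r_gt0 : 0 < r.

Lemma ball_sub_r_interior (L : set E) x :
  r_interior r L x -> euclidean_ball x r `<=` L.
Proof.
move=> [_ Lx] y xy; apply: contrapT => Ly.
have : (set_dist [set x] (~` L) <= (euclidean_dist x y)%:E)%E.
  by apply: ereal_inf_lbound; exists x => //; exists y.
by move=> /(le_trans Lx); rewrite lee_fin leNgt; apply/negP/negPn.
Qed.

Lemma hard_core_ball_uniq (X : config R d) x y z : hard_core r X ->
  y \in X -> z \in X -> euclidean_ball y r x -> euclidean_ball z r x -> y = z.
Proof.
move=> hX yX zX yx zx; apply/eqP/negPn/negP => /(hX _ _ yX zX); apply/negP.
rewrite -ltNge; apply: (le_lt_trans (euclidean_dist_triangle x _ _)).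
by rewrite mulr_natl mulr2n ltrD// euclidean_distC.
Qed.

(** The balls of radius [r] around the points of a hard-core configuration are disjoint, so a sum
    weighted by their indicators at [x] has a single nonzero weight. This serves both the volume
    bound on packings and the analysis of a deletion at [x]. *)
Lemma hard_core_ball_sum (X : config R d) (g : E -> R) x y : hard_core r X ->
  y \in X -> euclidean_ball y r x ->
  \sum_(z <- X) \1_(euclidean_ball z r) x * g z = g y.
Proof.
move=> hX yX yx; rewrite (big_fsetD1 y)//= indicE mem_set// mul1r.
rewrite big1_seq ?addr0// => z /andP[_]; rewrite !inE => /andP[zy zX].
rewrite indicE memNset ?mul0r// => zx; move/eqP : zy; apply.
exact: (hard_core_ball_uniq hX zX yX zx yx).
Qed.

Lemma hard_core_sub (X Y : config R d) : hard_core r X ->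
  {subset Y <= X} -> hard_core r Y.
Proof. by move=> hX YX x y /YX xX /YX yX; exact: hX. Qed.

Hypothesis r_unit_ball : lebesgue_rV (euclidean_ball (0 : E) r) = 1%E.

(** The indicators of the balls around the points sum to at most the indicator of [L], and each ball
    has volume 1. *)
Lemma packing_volume (L : set E) (X : config R d) : measurable L ->
  packings r (r_interior r L) X -> ((#|` X|)%:R%:E <= lebesgue_rV L)%E.
Proof.
move=> mL [XL hX].
rewrite (_ : _%:E = \int[@lebesgue_rV R d]_x
    \sum_(z <- X) (\1_(euclidean_ball z r) x)%:E)%E.
  have -> : lebesgue_rV L = (\int[@lebesgue_rV R d]_x (\1_L x)%:E)%E.
    by rewrite integral_indic// setIT.
  apply: ge0_le_integral => //.
  - by move=> x _; apply: sume_ge0 => z _; rewrite lee_fin.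
  - apply: emeasurable_sum => z; apply/measurable_EFinP/measurable_indic.
    exact: measurable_euclidean_ball.
  - exact/measurable_EFinP/measurable_indic.
  move=> x _; rewrite sumEFin lee_fin.
  have [[y yX yx]|nx] := pselect (exists2 y, y \in X & euclidean_ball y r x).
    under eq_bigr do rewrite -[indic _ _]mulr1.
    rewrite (hard_core_ball_sum (fun=> 1) hX yX yx).
    by rewrite indicE mem_set//; exact: (ball_sub_r_interior (XL _ yX)).
  rewrite big1_seq// => z /andP[_ zX]; rewrite indicE memNset// => zx.
  by apply: nx; exists z.
rewrite ge0_integral_sum//; last first.
  move=> z; apply/measurable_EFinP/measurable_indic.
  exact: measurable_euclidean_ball.
rewrite (eq_bigr (fun=> 1%:E)); last first.
  move=> z _; rewrite integral_indic//; last exact: measurable_euclidean_ball.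
  by rewrite setIT -[RHS]r_unit_ball; exact: lebesgue_euclidean_ball.
by rewrite sumEFin card_fset_sum1 natr_sum.
Qed.

(** Cardinalities are bounded by [packing_volume], so a packing of largest cardinality exists; a
    point at distance at least [2 * r] from all its points could be added to it. *)
Lemma maximal_packing (L : set E) : measurable L -> (lebesgue_rV L < +oo)%E ->
  exists2 P : config R d, packings r (r_interior r L) P &
    forall x, r_interior r L x -> exists2 y, y \in P & euclidean_dist x y < 2 * r.
Proof.
move=> mL Loo; pose p n := `[< exists2 P : config R d,
  packings r (r_interior r L) P & #|` P| = n >].
have p0 : exists n, p n.
  by exists 0%N; apply/asboolP; exists fset0 => //; split => x; rewrite inE.
have pub n : p n -> (n <= Num.truncn (fine (lebesgue_rV L)))%N.
  move=> /asboolP[P PP <-]; rewrite truncn_ge_nat; last exact: fine_ge0.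
  by rewrite -lee_fin fineK ?ge0_fin_numE//; exact: packing_volume.
have [n /asboolP[P PP Pn] nmax] := ex_maxnP p0 pub.
exists P => // x Lx; apply: contrapT => nx.
have xP : x \notin P.
  apply/negP => xP; apply: nx; exists x => //.
  by rewrite euclidean_distxx mulr_gt0.
have : p #|` x |` P|%fset.
  apply/asboolP; exists (x |` P)%fset => //; split => [y|y z].
    by rewrite !inE => /orP[/eqP->//|]; exact: PP.1.
  have far w : w \in P -> 2 * r <= euclidean_dist x w.
    by move=> wP; rewrite leNgt; apply/negP => xw; apply: nx; exists w.
  rewrite !inE => /orP[/eqP->|yP] /orP[/eqP->|zP] yz.
  - by rewrite eqxx in yz.
  - exact: far.
  - by rewrite euclidean_distC; exact: far.
  - exact: PP.2.
by move=> /nmax; rewrite cardfsU1 xP Pn add1n ltnn.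
Qed.

End packing.

(** * The Mecke identity *)

Lemma measurable_preimage d1 d2 (T1 : measurableType d1) (T2 : measurableType d2)
    (f : T1 -> T2) (B : set T2) :
  measurable_fun setT f -> measurable B -> measurable (f @^-1` B).
Proof. by move=> mf mB; rewrite -[X in measurable X]setTI; exact: mf. Qed.

Section tuple_mecke.
Context (R : realType) (d : nat).
Local Notation E := 'rV[R]_d.
Local Notation config := (config R d).
Variable mu : {sigma_finite_measure set E -> \bar R}.
Local Open Scope ereal_scope.

Definition omit_tuple k (i : 'I_k.+1) (t : k.+1.-tuple E) : k.-tuple E :=
  [tuple tnth t (lift i j) | j < k].

Lemma measurable_omit_tuple k (i : 'I_k.+1) : measurable_fun setT (omit_tuple i).
Proof.
apply/measurable_fun_tnthP => j.
rewrite (_ : _ \o _ = (fun t => tnth t (lift i j))); last first.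
  by apply/funext => t /=; rewrite tnth_mktuple.
exact: measurable_tnth.
Qed.

Lemma measurable_omit_pair k (i : 'I_k.+1) :
  measurable_fun setT (fun t => (config_of_tuple (omit_tuple i t), tnth t i)).
Proof.
apply: measurable_fun_pair; last exact: measurable_tnth.
exact: (measurableT_comp (@measurable_config_of_tuple R d k) (@measurable_omit_tuple k i)).
Qed.

Lemma config_of_tcons k (x : E) (t : k.-tuple E) :
  config_of_tuple (tcons (x, t)) = (x |` config_of_tuple t)%fset.
Proof. by apply/fsetP => y; rewrite !inE. Qed.

Lemma omit_tuple0 k (x : E) (t : k.-tuple E) : omit_tuple ord0 (tcons (x, t)) = t.
Proof. by apply: eq_from_tnth => j; rewrite tnth_mktuple tnthS. Qed.

Lemma omit_tupleS k (x : E) (t : k.+1.-tuple E) (i : 'I_k.+1) :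
  omit_tuple (lift ord0 i) (tcons (x, t)) = tcons (x, omit_tuple i t).
Proof.
apply: eq_from_tnth => j; rewrite tnth_mktuple.
case: (unliftP ord0 j) => [j' ->|->].
  rewrite [RHS]tnthS tnth_mktuple.
  rewrite (_ : lift (lift ord0 i) (lift ord0 j') = lift ord0 (lift i j')).
    by rewrite tnthS.
  by apply: val_inj; rewrite /= /bump /= !add1n ltnS addnS.
rewrite (_ : lift (lift ord0 i) ord0 = ord0) ?tnth0//.
exact: val_inj.
Qed.

(* Swapping the first two integrations in the induction step replaces permutation
   invariance of the power measure. *)
Lemma integral_omit_tuple k (i : 'I_k.+1) (F : config * E -> \bar R) :
  measurable_fun setT F -> (forall p, 0 <= F p) ->
  \int[power_measure mu k.+1]_t F (config_of_tuple (omit_tuple i t), tnth t i) =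
  \int[mu]_y \int[power_measure mu k]_t F (config_of_tuple t, y).
Proof.
elim: k i F => [|k ih] i F mF F0.
  rewrite ge0_integral_power_measureS; last 2 first.
  - exact: (measurableT_comp mF (measurable_omit_pair i)).
  - by move=> t; exact: F0.
  apply: eq_integral => x _; apply: eq_integral => t _.
  by rewrite (ord1 i) omit_tuple0.
rewrite ge0_integral_power_measureS; last 2 first.
- exact: (measurableT_comp mF (measurable_omit_pair i)).
- by move=> t; exact: F0.
case: (unliftP ord0 i) => [j ->|->]; last first.
  apply: eq_integral => x _; apply: eq_integral => t _.
  by rewrite omit_tuple0.
pose ins (p : (E * E) * k.-tuple E) : config * E :=
  (insert_center (config_of_tuple p.2, p.1.1), p.1.2).
have mins : measurable_fun setT ins.
  apply: measurable_fun_pair; last exact: (measurableT_comp measurable_snd measurable_fst).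
  apply: (measurableT_comp (f := @insert_center R d)
    (g := fun p : (E * E) * k.-tuple E => (config_of_tuple p.2, p.1.1))).
    exact: measurable_insert_center.
  apply: measurable_fun_pair.
    exact: (measurableT_comp (@measurable_config_of_tuple R d k) measurable_snd).
  exact: (measurableT_comp measurable_fst measurable_fst).
have mFins := measurableT_comp mF mins.
transitivity (\int[mu]_x \int[mu]_y \int[power_measure mu k]_t F (ins ((x, y), t))).
  apply: eq_integral => x _.
  rewrite -(ih j (fun p => F (insert_center (p.1, x), p.2)))//; last first.
    apply: (measurableT_comp mF).
    apply: measurable_fun_pair => //.
    apply: (measurableT_comp (@measurable_insert_center R d)).
    by apply: measurable_fun_pair.
  apply: eq_integral => t _; rewrite omit_tupleS config_of_tcons.
  by rewrite tnthS.
rewrite (fubini_tonelli (fun p : E * E => \int[power_measure mu k]_t F (ins (p, t))))//; last 2 first.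
- by apply: (measurable_fun_fubini_tonelli_F (F \o ins)) => // p; exact: F0.
- by move=> p; apply: integral_ge0.
have mc (y : E) : measurable_fun setT (fun t : k.+1.-tuple E => F (config_of_tuple t, y)).
  by apply: (measurableT_comp mF); apply: measurable_fun_pair.
apply: eq_integral => y _.
rewrite (ge0_integral_power_measureS mu (mc y) (fun t => F0 (config_of_tuple t, y))).
apply: eq_integral => x _; apply: eq_integral => t _.
by rewrite config_of_tcons.
Qed.

Hypothesis mu1 : forall x, mu [set x] = 0.

Lemma measure_config0 (X : config) : mu [set` X] = 0.
Proof.
rewrite (_ : [set` X] = \bigcup_(x in [set` X]) [set x]); last first.
  by apply/seteqP; split => [x Xx|x [y Xy ->]//]; exists x.
have m1 x : measurable [set x : E].
  by apply: closed_measurable_rV; exact: (accessible_closed_set1 (hausdorff_accessible (@norm_hausdorff _ _))).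
rewrite measure_fin_bigcup//.
  by rewrite fsbig1// => i _; exact: mu1.
by move=> x y _ _ [z [-> ->]].
Qed.

Lemma measurable_mem_config : measurable [set p : config * E | p.2 \in p.1].
Proof.
have m := measurable_exists_point (@measurable_diag R d).
have := @measurable_swap _ _ config E measurableT _ m.
rewrite setTI; congr measurable; apply/seteqP; split => -[X x] /=.
  by move=> [y yX ->].
by move=> xX; exists x.
Qed.

(** Once the other entries are fixed, entry [i] has to fall into a finite set, which is
    [mu]-null. *)
Lemma omit_tuple_mem0 k (i : 'I_k.+1) : power_measure mu k.+1
  [set t | tnth t i \in config_of_tuple (omit_tuple i t)] = 0.
Proof.
set A := [set t | _].
have mA : measurable A.
  exact: (measurable_preimage (measurable_omit_pair i) measurable_mem_config).
rewrite -[A]setIT -integral_indic//.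
pose F (p : config * E) : \bar R := (\1_[set p : config * E | p.2 \in p.1] p)%:E.
have mF : measurable_fun setT F.
  by apply/measurable_EFinP; apply: measurable_indic; exact: measurable_mem_config.
rewrite (_ : (\int[_]__ _) = \int[power_measure mu k.+1]_t
    F (config_of_tuple (omit_tuple i t), tnth t i))//.
rewrite integral_omit_tuple//; last by move=> p; rewrite lee_fin.
rewrite (fubini_tonelli (fun p : E * k.-tuple E => F (config_of_tuple p.2, p.1)))//=; last 2 first.
- apply: (measurableT_comp mF); apply: measurable_fun_pair => //.
  exact: (measurableT_comp (@measurable_config_of_tuple R d k) measurable_snd).
- by move=> p; rewrite lee_fin.
apply: integral0_eq => t _.
rewrite -[RHS](measure_config0 (config_of_tuple t)).
rewrite -[in RHS](setIT [set` _]) -integral_indic//.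
exact: (measurable_preimage (pair1_measurable (config_of_tuple t)) measurable_mem_config).
Qed.

(** [config_of_tuple] forgets multiplicities, so a sum over the points of the configuration is
    turned into a sum over indices only for tuples without repetition. *)
Lemma ae_uniq_tuple k : {ae power_measure mu k, forall t : k.-tuple E, uniq t}.
Proof.
case: k => [|k]; first by apply: aeW => t; rewrite tuple0.
pose N := \bigcup_n [set t : k.+1.-tuple E | exists2 i : 'I_k.+1,
  i = n :> nat & tnth t i \in config_of_tuple (omit_tuple i t)].
apply: (@negligibleS _ _ _ _ N).
  move=> t /= nt; apply: contrapT => Nt; apply: nt.
  apply/tuple_uniqP => i j tij; apply/eqP/negPn/negP => ij; apply: Nt.
  exists (val i) => //=; exists i => //; case: (unliftP i j) => [j' jE|jE]; last by rewrite jE eqxx in ij.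
  rewrite inE tij jE; apply/tnthP; exists j'.
  by rewrite tnth_mktuple.
apply: negligible_bigcup => n; have [nk|kn] := ltnP n k.+1; last first.
  apply: (negligibleS (A := set0)); last exact: negligible_set0.
  move=> t [i ni _] /=.
  by have := ltn_ord i; rewrite ni ltnNge kn.
apply: (@negligibleS _ _ _ _ [set t : k.+1.-tuple E |
  tnth t (Ordinal nk) \in config_of_tuple (omit_tuple (Ordinal nk) t)]).
  by move=> t [i ni] /=; rewrite (_ : Ordinal nk = i)//; exact: val_inj.
apply/negligibleP; last exact: omit_tuple_mem0.
exact: (measurable_preimage (measurable_omit_pair _) measurable_mem_config).
Qed.

End tuple_mecke.

Section poisson_mecke.
Context (R : realType) (d : nat).
Local Notation E := 'rV[R]_d.
Local Notation config := (config R d).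
Local Open Scope ereal_scope.

Definition remove_center (p : config * E) : config := (p.1 `\ p.2)%fset.

Lemma measurable_remove_center : measurable_fun setT remove_center.
Proof.
apply: measurable_config_fun => A mA.
pose C := ~` [set p : E * E | p.1 = p.2] `&` (setT `*` A).
have mC : measurable C.
  apply: measurableI; last exact: measurableX.
  exact: (measurableC (@measurable_diag R d)).
have m := @measurable_num_points_section R d _ E C mC.
have mns : measurable_fun setT (fun p : config * E => (p.2, p.1)).
  exact: measurable_swap.
rewrite (_ : (fun t => _) = (fun p : config * E =>
    (num_points [set y | C (p.2, y)] p.1)%:R)%R).
  exact: (measurableT_comp m mns).
apply/funext => -[X x]; congr (_%:R)%R; rewrite /num_points; congr (#|` _|).
apply/fsetP => y; rewrite !inE/= -andbA andbCA; congr andb.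
apply/andP/idP => [[yx /set_mem Ay]|/set_mem[yx [_ Ay]]].
  by apply/mem_set; split => //= xy; rewrite xy eqxx in yx.
by split; [apply/eqP => xy; exact: yx|exact: mem_set].
Qed.

Lemma measurable_num_removed (C : set (config * E)) : measurable C ->
  measurable_fun setT
    (fun X : config => (num_points [set y | C ((X `\ y)%fset, y)] X)%:R : R)%R.
Proof.
move=> mC; pose C' := [set p : config * E | C (remove_center p, p.2)].
have mC' : measurable C'.
  apply: (measurable_preimage (f := fun p : config * E => (remove_center p, p.2))) => //.
  by apply: measurable_fun_pair => //; exact: measurable_remove_center.
have mdup : measurable_fun setT (fun X : config => (X, X)).
  exact: measurable_fun_pair.
exact: (measurableT_comp (@measurable_num_points_section R d _ config C' mC') mdup).
Qed.

Lemma num_removed_tuple (C : set (config * E)) k (t : k.+1.-tuple E) : uniq t ->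
  (num_points [set y | C ((config_of_tuple t `\ y)%fset, y)] (config_of_tuple t))%:R =
  (\sum_(i < k.+1) \1_C (config_of_tuple (omit_tuple i t), tnth t i))%R :> R.
Proof.
move=> ut; rewrite num_pointsE.
rewrite (perm_big t); last first.
  by apply: uniq_perm; [exact: fset_uniq|by []|move=> y; rewrite !inE].
rewrite big_tuple; apply: eq_bigr => i _; rewrite !indicE; congr (_%:R)%R.
have E : (config_of_tuple t `\ tnth t i)%fset = config_of_tuple (omit_tuple i t).
  have /tuple_uniqP tinj := ut.
  apply/fsetP => y; rewrite !inE; apply/andP/(tnthP (omit_tuple i t) y) => [[yi /tnthP[j yj]]|[j ->]].
    case: (unliftP i j) => [j' jE|jE]; last by rewrite yj jE eqxx in yi.
    by exists j'; rewrite tnth_mktuple yj jE.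
  rewrite tnth_mktuple; split; last exact: mem_tnth.
  by apply/eqP => /tinj; apply/eqP; rewrite eq_sym neq_lift.
by congr nat_of_bool; apply/idP/idP => /set_mem h; apply/mem_set;
  move: h; rewrite /= E.
Qed.

Hypothesis d_gt0 : (0 < d)%N.
Variables (D : set E) (mD : measurable D).
Local Notation mu := (smrestr (@lebesgue_rV R d) mD).

Lemma smrestr_set1 x : mu [set x] = 0.
Proof.
apply/eqP; rewrite eq_le measure_ge0 andbT -(lebesgue_rV_set1 x d_gt0).
rewrite /smrestr/= /mrestr; apply: le_measure; rewrite ?inE//.
- apply: measurableI => //; apply: closed_measurable_rV.
  exact: (accessible_closed_set1 (hausdorff_accessible (@norm_hausdorff _ _))).
- apply: closed_measurable_rV.
  exact: (accessible_closed_set1 (hausdorff_accessible (@norm_hausdorff _ _))).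
Qed.

(** Almost everywhere the count is a sum over the index of the removed point, and by
    [integral_omit_tuple] each of the [k.+1] indices contributes the same integral. *)
Lemma points_law_mecke k (C : set (config * E)) : measurable C ->
  \int[points_law mD k.+1]_X (num_points [set y | C ((X `\ y)%fset, y)] X)%:R%:E =
  k.+1%:R%:E * \int[points_law mD k]_X mu (xsection C X).
Proof.
move=> mC; rewrite (ge0_integral_pushforward (@measurable_config_of_tuple R d k.+1))//; last first.
  by apply/measurable_EFinP; exact: measurable_num_removed.
rewrite (ge0_integral_pushforward (@measurable_config_of_tuple R d k))//; last first.
  exact: measurable_fun_xsection.
rewrite !preimage_setT.
have mF : measurable_fun setT (fun p : config * E => (\1_C p)%:E : \bar R).
  by apply/measurable_EFinP; exact: measurable_indic.
transitivity (\int[power_measure mu k.+1]_t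
  \sum_(i < k.+1) (\1_C (config_of_tuple (omit_tuple i t), tnth t i))%:E).
  apply: ge0_ae_eq_integral => //=.
  - apply: (measurableT_comp (f := fun X : config => _)); last exact: measurable_config_of_tuple.
    by apply/measurable_EFinP; exact: measurable_num_removed.
  - apply: emeasurable_sum => i; exact: (measurableT_comp mF (measurable_omit_pair i)).
  - by move=> t _; apply: sume_ge0 => i _; rewrite lee_fin.
  apply: filterS (ae_uniq_tuple smrestr_set1 k.+1) => t ut _.
  by rewrite sumEFin -num_removed_tuple.
rewrite ge0_integral_sum//; last first.
  move=> i; exact: (measurableT_comp mF (measurable_omit_pair i)).
under eq_bigr => i _ do rewrite (integral_omit_tuple mu i mF)// -(mul1e (\int[mu]__ _)).
rewrite -ge0_sume_distrl// sumEFin sumr_const card_ord; congr (_ * _).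
rewrite (fubini_tonelli (fun p : E * k.-tuple E => (\1_C (config_of_tuple p.2, p.1))%:E))//=; last first.
  apply: (measurableT_comp mF); apply: measurable_fun_pair => //.
  exact: (measurableT_comp (@measurable_config_of_tuple R d k) measurable_snd).
apply: eq_integral => t _.
have mx : measurable (xsection C (config_of_tuple t)) by exact: measurable_xsection.
transitivity (\int[mu]_y (\1_(xsection C (config_of_tuple t)) y)%:E); last first.
  by rewrite integral_indic// setIT.
apply: eq_integral => y _; rewrite !indicE; congr (_%:R%:E).
by rewrite /xsection; congr nat_of_bool; apply/idP/idP => [h|/set_mem]//; exact: mem_set.
Qed.

Local Notation weight lam k :=
  (expR (- (lam%:num * fine (lebesgue_rV D))) * lam%:num ^+ k / k`!%:R)%R.

Lemma ge0_integral_poisson (lam : {posnum R}) (f : config -> \bar R) :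
  measurable_fun setT f -> (forall X, 0 <= f X) ->
  \int[poisson_process lam mD]_X f X =
  \sum_(0 <= k <oo) (weight lam k)%:E * \int[points_law mD k]_X f X.
Proof.
move=> mf f0; rewrite /poisson_process ge0_integral_measure_series//.
by apply: eq_eseriesr => k _; rewrite ge0_integral_mscale.
Qed.

(** An index shift in the Poisson series: the weight of [k.+1] points times [k.+1] is [lam] times
    the weight of [k] points, and the empty configuration contributes nothing on the left. *)
Lemma poisson_mecke (lam : {posnum R}) (C : set (config * E)) : measurable C ->
  \int[poisson_process lam mD]_X (num_points [set y | C ((X `\ y)%fset, y)] X)%:R%:E =
  lam%:num%:E * \int[poisson_process lam mD]_X mu (xsection C X).
Proof.
move=> mC; rewrite !ge0_integral_poisson//; last 2 first.
- exact: measurable_fun_xsection.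
- by apply/measurable_EFinP; exact: measurable_num_removed.
rewrite -nneseriesZl; last first.
  by move=> k _; apply: mule_ge0; [rewrite lee_fin poisson_weight_ge0|apply: integral_ge0].
rewrite nneseries_recl//; last first.
  by move=> k _; apply: mule_ge0; [rewrite lee_fin poisson_weight_ge0|apply: integral_ge0].
rewrite [X in X + _](_ : _ = 0) ?add0e; last first.
  rewrite (ge0_integral_pushforward (@measurable_config_of_tuple R d 0))//; last first.
    by apply/measurable_EFinP; exact: measurable_num_removed.
  rewrite integral0_eq ?mule0// => t _ /=.
  rewrite tuple0 /num_points (_ : [fset _ in _ | _]%fset = fset0) ?cardfs0//.
  by apply/fsetP => x; rewrite !inE.
rewrite -nneseries_addn; last first.
  by move=> k; apply: mule_ge0; [rewrite lee_fin poisson_weight_ge0|apply: integral_ge0].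
apply: eq_eseriesr => k _; rewrite addn1 points_law_mecke// !muleA.
congr (_ * _); rewrite -!EFinM; congr (_%:E).
rewrite factS natrM exprS invfM.
have k0 : (k.+1%:R != 0 :> R)%R by rewrite pnatr_eq0.
rewrite -!mulrA [RHS]mulrCA; do 3 congr (_ * _)%R.
by rewrite mulrCA mulVf// mulr1.
Qed.

End poisson_mecke.

Section measure_integral_lemmas.
Context d (T : measurableType d) (R : realType).
Local Open Scope ereal_scope.

Lemma ge0_integral_mrestr (mu : {measure set T -> \bar R}) (D : set T)
    (mD : measurable D) (f : T -> \bar R) :
  measurable_fun setT f -> (forall x, 0 <= f x) ->
  \int[mrestr mu mD]_x f x = \int[mu]_(x in D) f x.
Proof.
move=> mf f0; rewrite (@ge0_negligible_integral _ _ _ (mrestr mu mD) setT (~` D) f (measurableC mD))//; last first.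
  by transitivity (mu (~` D `&` D)) => //; rewrite setICl measure0.
rewrite setTD setCK; apply: eq_measure_integral => A mA AD.
by transitivity (mu (A `&` D)) => //; rewrite setIidl.
Qed.

Lemma markov_nat (mu : {measure set T -> \bar R}) (n : T -> nat) :
  measurable_fun setT (fun x => (n x)%:R : R) ->
  mu [set x | (0 < n x)%N] <= \int[mu]_x (n x)%:R%:E.
Proof.
move=> mn; have mA : measurable [set x | (0 < n x)%N].
  rewrite (_ : [set x | _] = (fun x => (n x)%:R : R) @^-1` (`]0, +oo[%classic)%R).
    exact: measurable_preimage.
  by apply/seteqP; split => x /=; rewrite in_itv/= andbT ltr0n.
have -> : mu [set x | (0 < n x)%N] = \int[mu]_x (\1_[set x | (0 < n x)%N] x)%:E.
  by rewrite integral_indic// setIT.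
apply: ge0_le_integral => //.
- by apply/measurable_EFinP; exact: measurable_indic.
- exact/measurable_EFinP.
move=> x _; rewrite lee_fin indicE; case: (boolP (x \in _)) => [/set_mem /=|]//=.
by rewrite ler1n.
Qed.

Lemma power_measure_setT (mu : {sigma_finite_measure set T -> \bar R}) k :
  power_measure mu k setT = mu setT ^+ k.
Proof.
elim: k => [|k ih]; first by rewrite /= diracE mem_set.
rewrite expeS -ih [LHS]/= /cons_measure /pushforward preimage_setT -setXTT.
by rewrite product_measure1E.
Qed.

End measure_integral_lemmas.

Lemma nneseries_exp_coeff (R : realType) (x : R) :
  (\sum_(0 <= k <oo) (x ^+ k / k`!%:R)%:E = (expR x)%:E)%E.
Proof.
rewrite expRE -EFin_lim; last first.
  rewrite /pseries/=; under eq_fun do rewrite mulrC.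
  exact: is_cvg_series_exp_coeff.
apply/congr_lim/funext => n/=; rewrite /pseries/= /series/= -sumEFin//.
by under eq_bigr do rewrite mulrC.
Qed.

Lemma measurable_set_config (R : realType) (d : nat) (X : config R d) :
  measurable [set` X].
Proof.
rewrite (_ : [set` X] = \bigcup_(x in [set` X]) [set x]); last first.
  by apply/seteqP; split => [x Xx|x [y Xy ->]//]; exists x.
apply: fin_bigcup_measurable => // x _; apply: closed_measurable_rV.
exact: (accessible_closed_set1 (hausdorff_accessible (@norm_hausdorff _ _))).
Qed.

(** * The hard sphere measure and its Mecke identity *)

Section hard_sphere_mecke.
Context (R : realType) (d : nat) (d_gt0 : (0 < d)%N) (r : R) (lam : {posnum R}).
Local Notation E := 'rV[R]_d.
Local Notation config := (config R d).
Local Open Scope ereal_scope.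
Variables (L : region R d) (t : boundary_condition r L).
Local Notation D := (centers t).
Local Notation mD := (measurable_centers t).
Local Notation pois := (poisson_process lam mD).
Local Notation HC := (@measurable_hard_core R d r).
Local Notation nu := (mrestr pois HC).
Local Notation hs := (hard_sphere lam t).

Lemma centers_sub : D `<=` r_interior r L.
Proof. by move=> x []. Qed.

Lemma lebesgue_centers_lty : lebesgue_rV D < +oo.
Proof.
apply: le_lt_trans (lebesgue_rV_compact_lty (@region_compact _ _ L) (@region_measurable _ _ L)).
apply: le_measure; rewrite ?inE.
- exact: measurable_centers.
- exact: region_measurable.
by move=> x /centers_sub[].
Qed.

Lemma poisson_mass_lty : pois setT < +oo.
Proof.
rewrite -[pois setT]mul1e -integral_cst// ge0_integral_poisson//.
pose v := fine (lebesgue_rV D).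
have vE : lebesgue_rV D = v%:E.
  by rewrite fineK// ge0_fin_numE// lebesgue_centers_lty.
rewrite (eq_eseriesr (g := fun k => (expR (- (lam%:num * v)))%:E * ((lam%:num * v) ^+ k / k`!%:R)%:E)).
  rewrite nneseriesZl; last first.
    by move=> k _; rewrite lee_fin divr_ge0// exprn_ge0// mulr_ge0// fine_ge0.
  by rewrite nneseries_exp_coeff -EFinM ltry.
have plE k : points_law mD k setT = lebesgue_rV D ^+ k.
  transitivity (power_measure (smrestr (@lebesgue_rV R d) mD) k setT) => //.
  rewrite power_measure_setT; congr (_ ^+ _).
  by transitivity (lebesgue_rV (setT `&` D)) => //; rewrite setTI.
move=> k _; rewrite integral_cst// mul1e.
rewrite [X in _ * X](plE k) vE -EFin_expe -!EFinM.
by congr (_%:E); rewrite exprMn !mulrA -/v mulrAC.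
Qed.

Lemma hard_core_mass_gt0 : 0 < pois [set X | hard_core r X].
Proof.
have pE : pois [set X | hard_core r X] = \int[pois]_X (\1_[set X : config | hard_core r X] X)%:E.
  by rewrite integral_indic ?setIT//; exact: measurable_hard_core.
rewrite pE ge0_integral_poisson//; last first.
  by apply/measurable_EFinP; apply: measurable_indic; exact: measurable_hard_core.
rewrite nneseries_recl//; last first.
  by move=> k _; apply: mule_ge0; [rewrite lee_fin poisson_weight_ge0|apply: integral_ge0].
apply: (@lt_le_trans _ _ (expR (- (lam%:num * fine (lebesgue_rV D))))%:E).
  by rewrite lte_fin expR_gt0.
rewrite [X in X + _](_ : _ = (expR (- (lam%:num * fine (lebesgue_rV D))))%:E).
  apply: leeDl; apply: nneseries_ge0 => k _ _.
  by apply: mule_ge0; [rewrite lee_fin poisson_weight_ge0|apply: integral_ge0].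
rewrite expr0 mulr1 fact0 divr1 integral_indic//; last exact: measurable_hard_core.
rewrite setIT [X in _ * X](_ : _ = 1) ?mule1//.
transitivity (\d_([tuple] : 0.-tuple E) (@config_of_tuple R d 0 @^-1`
  [set X : config | hard_core r X]) : \bar R) => //.
rewrite diracE mem_set//= => x y.
by rewrite !inE.
Qed.

Local Notation Z := (fine (pois [set X | hard_core r X])).

Lemma hard_core_mass_fin : pois [set X | hard_core r X] = Z%:E.
Proof.
rewrite fineK// ge0_fin_numE//; apply: le_lt_trans poisson_mass_lty.
by apply: le_measure; rewrite ?inE//; exact: measurable_hard_core.
Qed.

Lemma hard_core_mass_fine_gt0 : (0 < Z)%R.
Proof. by rewrite -lte_fin -hard_core_mass_fin; exact: hard_core_mass_gt0. Qed.

Lemma hard_sphereE A : hs A = (Z^-1)%:E * pois (A `&` [set X | hard_core r X]).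
Proof.
have nuT : nu setT = Z%:E.
  by rewrite -hard_core_mass_fin; transitivity (pois (setT `&` [set X | hard_core r X])) => //; rewrite setTI.
rewrite /hard_sphere /= /mnormalize /= nuT eqe gt_eqF ?hard_core_mass_fine_gt0//=.
by rewrite muleC.
Qed.

Lemma ge0_integral_hard_sphere (f : config -> \bar R) :
  measurable_fun setT f -> (forall X, 0 <= f X) ->
  \int[hs]_X f X =
  (Z^-1)%:E * \int[pois]_(X in [set X | hard_core r X]) f X.
Proof.
move=> mf f0.
have Z0 : (0 <= Z^-1)%R by rewrite invr_ge0 ltW// hard_core_mass_fine_gt0.
transitivity (\int[mscale (NngNum Z0) nu]_X f X).
  by apply: eq_measure_integral => A mA _; exact: hard_sphereE.
by rewrite ge0_integral_mscale// ge0_integral_mrestr.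
Qed.

Lemma measurable_admissible (C : set (config * E)) : measurable C ->
  measurable [set p : config * E | [/\ D p.2, C p & hard_core r (insert_center p)]].
Proof.
move=> mC; rewrite (_ : [set p | _] = (setT `*` D) `&` C `&`
    (@insert_center R d @^-1` [set X : config | hard_core r X])).
  apply: measurableI; [apply: measurableI => //|].
  - by apply: measurableX => //; exact: measurable_centers.
  - apply: measurable_preimage; first exact: measurable_insert_center.
    exact: measurable_hard_core.
apply/seteqP; split => p; first by case=> Dp Cp hp; split => //; split.
by case=> -[[_ Dp] Cp] hp; split.
Qed.

(** The conditioning is absorbed into the set [C'] to which [poisson_mecke] is applied. On the left,
    reinserting the removed point gives back [X], so only hard-core [X] count; on the right, a
    hard-core enlargement of [X] makes [X] itself hard core. The points already in [X] form a
    finite, hence null, set. *)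
Lemma hard_sphere_mecke (C : set (config * E)) : measurable C ->
  \int[hs]_X (num_points [set y | C ((X `\ y)%fset, y)] X)%:R%:E =
  lam%:num%:E * \int[hs]_X lebesgue_rV
    [set y | [/\ D y, C (X, y) & hard_core r (y |` X)%fset]].
Proof.
move=> mC; have mA := measurable_admissible mC.
set A := [set p : config * E | _] in mA.
have AE X : [set y | [/\ D y, C (X, y) & hard_core r (y |` X)%fset]] = xsection A X.
  by rewrite xsectionE.
under [in RHS]eq_integral do rewrite AE.
rewrite !ge0_integral_hard_sphere//; last 2 first.
- exact: measurable_fun_xsection.
- by apply/measurable_EFinP; exact: measurable_num_removed.
rewrite muleCA; congr (_ * _).
pose C' := [set p : config * E | [/\ C p, p.2 \notin p.1 & hard_core r (insert_center p)]].
have mC' : measurable C'.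
  rewrite (_ : C' = C `&` ~` [set p : config * E | p.2 \in p.1] `&`
      (@insert_center R d @^-1` [set X : config | hard_core r X])).
    apply: measurableI; [apply: measurableI => //|].
    - by apply: measurableC; exact: measurable_mem_config.
    - apply: measurable_preimage; first exact: measurable_insert_center.
      exact: measurable_hard_core.
  apply/seteqP; split => p.
    by case=> Cp /negP pp hp; split => //; split.
  by case=> -[Cp /negP pp] hp; split.
have insHC (X : config) y : hard_core r (y |` X)%fset -> hard_core r X.
  by move=> hX; apply: hard_core_sub hX _ => z zX; rewrite !inE zX orbT.
have := poisson_mecke d_gt0 mD lam mC'.
rewrite (_ : \int[pois]_X _ = \int[pois]_(X in [set X | hard_core r X])
    (num_points [set y | C ((X `\ y)%fset, y)] X)%:R%:E) => [->|]; last first.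
  rewrite [RHS]integral_mkcond; apply: eq_integral => X _; rewrite patchE.
  case: ifPn => [/set_mem hX|/negP hX].
    congr (_%:R%:E); congr (#|` _|); apply/fsetP => y; rewrite !inE/=.
    apply: andb_id2l => yX; apply/idP/idP => /set_mem h; apply/mem_set.
      by case: h.
    split => //=; first by rewrite !inE eqxx.
    by rewrite /insert_center/= fsetD1K.
  congr (_%:E); rewrite /num_points (_ : [fset _ in _ | _]%fset = fset0) ?cardfs0//.
  apply/fsetP => y; rewrite !inE/=; apply/negP => /andP[yX /set_mem[_ _]].
  rewrite /insert_center/= fsetD1K// => h; exact/hX/mem_set.
congr (_ * _); rewrite [RHS]integral_mkcond; apply: eq_integral => X _.
rewrite patchE; case: ifPn => [/set_mem hX|/negP hX]; last first.
  rewrite (_ : xsection C' X = set0) ?measure0//.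
  apply/seteqP; split => y //; rewrite xsectionE => -[_ _ /insHC h].
  exact/hX/mem_set.
have mX := measurable_set_config X.
have mS := @measurable_xsection _ _ _ _ A X mA.
rewrite [RHS](@measureDI _ _ _ (@lebesgue_rV R d) _ _ mS mX).
rewrite [X in _ + X](_ : _ = 0) ?adde0; last first.
  apply: (@subset_measure0 _ _ _ (@lebesgue_rV R d) _ [set` X]) => //.
  - exact: measurableI.
  - by apply: measure_config0 => x; exact: lebesgue_rV_set1.
transitivity (lebesgue_rV (xsection C' X `&` D)) => //.
congr lebesgue_rV; rewrite !xsectionE; apply/seteqP; split => y /=.
  by move=> [[Cy /negP yX hy] Dy]; split.
by move=> [[Dy Cy hy] /negP yX]; split.
Qed.

(** For the set of pairs whose point lies outside [D] the right side of the Mecke identity vanishes,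
    so the expected number of points outside [D] is 0. *)
Lemma hard_sphere_packings : hs (packings r D) = 1.
Proof.
have mhc := @measurable_hard_core R d r.
have mp : measurable (packings r D) by apply: measurable_packings; exact: measurable_centers.
have hsHC : hs [set X | hard_core r X] = 1.
  rewrite hard_sphereE setIid hard_core_mass_fin -EFinM mulVf//.
  by rewrite gt_eqF// hard_core_mass_fine_gt0.
have mC : measurable ([set: config] `*` ~` D).
  by apply: measurableX => //; apply: measurableC; exact: measurable_centers.
have mout := measurable_num_points (measurableC mD).
have := hard_sphere_mecke mC.
rewrite [X in _ = _ * X](_ : _ = 0); last first.
  apply: integral0_eq => X _; rewrite (_ : [set y | _] = set0) ?measure0//.
  by apply/seteqP; split => y // -[Dy [_ nDy]].
rewrite mule0 (_ : \int[hs]_X _ = \int[hs]_X (num_points (~` D) X)%:R%:E); last first.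
  apply: eq_integral => X _; congr (num_points _ X)%:R%:E.
  by apply/seteqP; split => y // -[].
move=> num0; have out0 : hs [set X | (0 < num_points (~` D) X)%N] = 0.
  apply/eqP; rewrite eq_le measure_ge0 andbT -num0.
  exact: (@markov_nat _ _ _ hs).
have mo : measurable [set X : config | (0 < num_points (~` D) X)%N].
  rewrite (_ : [set x | _] = (fun X => (num_points (~` D) X)%:R : R) @^-1` (`]0, +oo[%classic)%R).
    exact: measurable_preimage.
  by apply/seteqP; split => x /=; rewrite in_itv/= andbT ltr0n.
have := @measureDI _ _ _ hs _ _ mhc mo.
rewrite [X in _ + X](_ : _ = 0) ?adde0; last first.
  apply: (@subset_measure0 _ _ _ hs _ [set X | (0 < num_points (~` D) X)%N]) => //.
  exact: measurableI.
move=> hE; apply: (etrans _ (etrans (esym hE) hsHC)); congr (hs _).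
apply/seteqP; split => X.
  move=> [XD hX]; split => // /num_points_gt0[x xX].
  by move=> /(_ (XD _ xX)).
move=> [hX nX]; split => // x xX; apply: contrapT => Dx; apply: nX.
by apply/num_points_gt0; exists x.
Qed.

End hard_sphere_mecke.

(** * Dynamics restricted to a subregion *)

Section update_integral.
Context (R : realType) (d : nat) (lam : {posnum R}) (L : region R d).
Local Notation E := 'rV[R]_d.
Local Open Scope ereal_scope.
Hypothesis L_gt0 : 0 < lebesgue_rV L.
Local Notation n := (fine (lebesgue_rV L)).

Lemma region_volume_fin : lebesgue_rV L = n%:E.
Proof.
rewrite fineK// ge0_fin_numE//.
by apply: lebesgue_rV_compact_lty; [exact: region_compact|exact: region_measurable].
Qed.

Lemma region_volume_fine_gt0 : (0 < n)%R.
Proof. by rewrite -lte_fin -region_volume_fin. Qed.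

Lemma ge0_integral_uniform_on (f : E -> \bar R) :
  measurable_fun setT f -> (forall x, 0 <= f x) ->
  \int[uniform_on L]_x f x = (n^-1)%:E * \int[@lebesgue_rV R d]_(x in L) f x.
Proof.
move=> mf f0; have n0 : (0 <= n^-1)%R by rewrite invr_ge0 fine_ge0.
transitivity (\int[mscale (NngNum n0) (mrestr (@lebesgue_rV R d) (region_measurable L))]_x f x).
  apply: eq_measure_integral => A mA _.
  have LT : mrestr (@lebesgue_rV R d) (region_measurable L) setT = n%:E.
    by rewrite -region_volume_fin; transitivity (lebesgue_rV (setT `&` L)) => //; rewrite setTI.
  rewrite /uniform_on /= /mnormalize /= LT eqe gt_eqF ?region_volume_fine_gt0//=.
  by rewrite muleC.
by rewrite ge0_integral_mscale// ge0_integral_mrestr.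
Qed.

(** Up to the common factor, insertions have rate [lam] and deletions rate 1; this ratio is the
    constant of the Mecke identity. *)
Lemma ge0_integral_update_choice (f : E * bool -> \bar R) :
  measurable_fun setT f -> (forall u, 0 <= f u) ->
  \int[update_choice lam L]_u f u =
  (((1 + lam%:num) * n)^-1)%:E *
    (lam%:num%:E * \int[@lebesgue_rV R d]_(x in L) f (x, true) +
     \int[@lebesgue_rV R d]_(x in L) f (x, false)).
Proof.
move=> mf f0; have mL := @region_measurable _ _ L.
pose p := (lam%:num / (1 + lam%:num))%R.
have l0 : (0 < 1 + lam%:num)%R by rewrite addr_gt0.
have p0 : (0 <= p)%R by rewrite divr_ge0// ltW.
have p1 : (p <= 1)%R by rewrite ler_pdivrMr// mul1r lerDr.
have p01 : (0 <= p <= 1)%R by rewrite p0 p1.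
have q0 : (0 <= 1 - p)%R by rewrite subr_ge0.
have mfb b : measurable_fun setT (fun x => f (x, b)).
  exact: (measurableT_comp mf (pair2_measurable b)).
transitivity (\int[uniform_on L]_x \int[bernoulli_prob p]_b f (x, b)).
  exact: fubini_tonelli1.
under eq_integral do rewrite integral_bernoulli_prob//.
rewrite ge0_integral_uniform_on; last 2 first.
- by apply: emeasurable_funD; apply: emeasurable_funM.
- by move=> x; apply: adde_ge0; apply: mule_ge0.
rewrite ge0_integralD//; last 4 first.
- by move=> x _; apply: mule_ge0.
- by apply: emeasurable_funM => //; apply: measurable_funTS; exact: mfb.
- by move=> x _; apply: mule_ge0.
- by apply: emeasurable_funM => //; apply: measurable_funTS; exact: mfb.
rewrite !ge0_integralZl//; try exact: measurable_funTS.
set I := \int[_]_(x in L) f (x, true); set J := \int[_]_(x in L) f (x, false).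
have I0 : 0 <= I by exact: integral_ge0.
have J0 : 0 <= J by exact: integral_ge0.
clearbody I J; rewrite !ge0_muleDr//; try by apply: mule_ge0; rewrite ?lee_fin.
rewrite !muleA -!EFinM; congr (_%:E * _ + _%:E * _).
  by rewrite /p invfM mulrC [RHS]mulrC mulrA.
rewrite invfM [RHS]mulrC; congr (_ * _)%R.
rewrite /unstable.onem /p -[X in (X - _)%R](divff (lt0r_neq0 l0)) -mulrBl addrK.
by rewrite mul1r.
Qed.

End update_integral.

Lemma ae_probability1 d (T : measurableType d) (R : realType) (P : probability T R)
    (A : set T) : measurable A -> P A = 1%E -> {ae P, forall x, A x}.
Proof.
move=> mA PA; apply/negligibleP; first exact: measurableC.
by apply: (etrans (probability_setC P mA)); rewrite PA subee.
Qed.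

Section local_dynamics.
Context (R : realType) (d : nat) (d_gt0 : (0 < d)%N) (r : R) (lam : {posnum R}).
Local Notation E := 'rV[R]_d.
Local Notation config := (config R d).
Variables (L : region R d) (t : boundary_condition r L).
Local Notation D := (centers t).
Variables (N : set E) (mN : measurable N).

(* Single-center dynamics on L whose insertions and deletions only concern centers
   in N. *)
Definition local_delete (p : config * E) : config :=
  [fset y in p.1 | y \notin (euclidean_ball p.2 r `&` N)%classic]%fset.

Definition local_step (p : config * (E * bool)) : config :=
  let: (X, (x, add)) := p in
  if add then
    let X' := insert_center (X, x) in
    if (x \in N) && (X' \in packings r D) then X' else X
  else local_delete (X, x).

Lemma measurable_local_delete : measurable_fun setT local_delete.
Proof.
apply: measurable_config_fun => A mA.
pose C := ~` ([set p : E * E | euclidean_dist p.1 p.2 < r] `&` (setT `*` N)) `&` (setT `*` A).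
have mC : measurable C.
  apply: measurableI; last exact: measurableX.
  by apply: measurableC; apply: measurableI; [exact: measurable_close|exact: measurableX].
have m := @measurable_num_points_section R d _ E C mC.
have mns : measurable_fun setT (fun p : config * E => (p.2, p.1)).
  exact: measurable_swap.
rewrite (_ : (fun t => _) = (fun p : config * E =>
    (num_points [set y | C (p.2, y)] p.1)%:R)).
  exact: (measurableT_comp m mns).
apply/funext => -[X x]; congr (_%:R); rewrite /num_points; congr (#|` _|).
apply/fsetP => y; rewrite !inE/= -andbA; congr andb.
apply/andP/idP => [[/negP yb /set_mem Ay]|/set_mem[yb [_ Ay]]].
  apply/mem_set; split; last by split.
  by move=> [h [_ Ny]]; apply: yb; apply: mem_set.
split; [apply/negP => /set_mem[h Ny]|exact: mem_set].
by apply: yb; split.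
Qed.

Lemma measurable_local_step : measurable_fun setT local_step.
Proof.
have mX : measurable_fun setT (fun p : config * (E * bool) => p.1).
  exact: measurable_fst.
have mx : measurable_fun setT (fun p : config * (E * bool) => (p.1, p.2.1)).
  apply: measurable_fun_pair => //.
  exact: (measurableT_comp measurable_fst measurable_snd).
have mi := measurableT_comp (@measurable_insert_center R d) mx.
have mb : measurable_fun setT (fun p : config * (E * bool) => p.2.2).
  exact: (measurableT_comp measurable_snd measurable_snd).
rewrite (_ : local_step = fun p => if p.2.2 then
    if (p.2.1 \in N) && (insert_center (p.1, p.2.1) \in packings r D)
    then insert_center (p.1, p.2.1) else p.1
    else local_delete (p.1, p.2.1)); last by apply/funext => -[X [x []]].
apply: measurable_fun_ifT => //; last first.
  exact: (measurableT_comp measurable_local_delete mx).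
apply: measurable_fun_ifT => //; apply: (measurable_fun_bool true).
rewrite (_ : _ @^-1` _ = ((fun p : config * (E * bool) => p.2.1) @^-1` N) `&`
  ((fun p : config * (E * bool) => insert_center (p.1, p.2.1)) @^-1`
    packings r D)).
  have m1 : measurable_fun setT (fun p : config * (E * bool) => p.2.1).
    exact: (measurableT_comp measurable_fst measurable_snd).
  rewrite setTI; apply: measurableI; first exact: (measurable_preimage m1 mN).
  exact: (measurable_preimage mi (@measurable_packings R d r _ (measurable_centers t))).
apply/seteqP; split => p /=.
  by move=> /andP[/set_mem ? /set_mem].
by move=> [? ?]; apply/andP; split; exact: mem_set.
Qed.

End local_dynamics.

(** * Stationarity of the hard sphere measure under the restricted dynamics *)

Section stationarity.
Context (R : realType) (d : nat) (d_gt0 : (0 < d)%N) (r : R) (lam : {posnum R}).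
Local Notation E := 'rV[R]_d.
Local Notation config := (config R d).
Hypothesis r_gt0 : 0 < r.
Hypothesis r_unit_ball : lebesgue_rV (euclidean_ball (0 : E) r) = 1%E.
Variables (L : region R d) (t : boundary_condition r L).
Local Notation D := (centers t).
Variables (N : set E) (mN : measurable N) (L1 : region R d).
Hypothesis L1_gt0 : (0 < lebesgue_rV L1)%E.
Hypothesis ball_sub : forall y, D y -> N y -> euclidean_ball y r `<=` L1.
Local Notation n := (fine (lebesgue_rV L1)).
Local Notation hs := (hard_sphere lam t).
Local Notation leb := (@lebesgue_rV R d).

(** A center [y] is deleted when the location [x] falls into its ball. Where [g y] is nonzero this
    ball lies in [L1] and has volume 1, so integration over [x] gives each such center unit deletion
    rate. *)
Lemma integral_ball_sum (s : seq E) (g : E -> R) :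
  (forall y, 0 <= g y) ->
  (forall y, y \in s -> g y != 0 -> euclidean_ball y r `<=` L1) ->
  (\int[leb]_(x in L1) (\sum_(y <- s) \1_(euclidean_ball y r) x * g y)%:E =
   (\sum_(y <- s) g y)%:E)%E.
Proof.
move=> g0 gL; have mL := @region_measurable _ _ L1.
under eq_integral do rewrite -sumEFin.
have mb y : measurable (euclidean_ball y r) := measurable_euclidean_ball y r.
rewrite ge0_integral_sum//; last 2 first.
- move=> y; apply/measurable_EFinP.
  by apply: measurable_funM; [apply: measurable_indic|exact: measurable_cst].
- by move=> y x _; rewrite lee_fin mulr_ge0.
rewrite -sumEFin; apply: eq_big_seq => y ys.
under eq_integral do rewrite EFinM.
rewrite ge0_integralZr//; last 2 first.
- by apply/measurable_EFinP; exact: measurable_indic.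
- by rewrite lee_fin.
have [->|gy] := eqVneq (g y) 0; first by rewrite mule0.
rewrite integral_indic// setIidl; last exact: gL.
rewrite [X in (X * _)%E](_ : _ = 1%E) ?mul1e//.
by rewrite -[RHS]r_unit_ball; exact: lebesgue_euclidean_ball.
Qed.

Variables (A : set config) (mA : measurable A).
Local Notation h X := (\1_A X : R).

(* The balls of radius r around the points of X are disjoint: at most one term of
   each sum is nonzero. *)
Lemma local_delete_balance (X : config) x : hard_core r X ->
  h (local_delete r N (X, x)) +
    \sum_(y <- X) \1_(euclidean_ball y r) x * (\1_N y * h X) =
  h X + \sum_(y <- X) \1_(euclidean_ball y r) x * (\1_N y * h (X `\ y)%fset).
Proof.
move=> hX.
have [[y yX yx]|nx] := pselect (exists2 y, y \in X & euclidean_ball y r x); last first.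
  rewrite !big1_seq ?addr0.
  - congr (\1_A _); apply/fsetP => y; rewrite !inE/=.
    rewrite andb_idr// => yX; apply/negP => /set_mem[xy _]; apply: nx.
    by exists y => //; apply/euclidean_ball_sym.
  - move=> y /andP[_ yX]; rewrite indicE memNset ?mul0r// => yx.
    by apply: nx; exists y.
  - move=> y /andP[_ yX]; rewrite indicE memNset ?mul0r// => yx.
    by apply: nx; exists y.
rewrite (hard_core_ball_sum (fun z => \1_N z * h X) hX yX yx).
rewrite (hard_core_ball_sum (fun z => \1_N z * h (X `\ z)%fset) hX yX yx).
have [Ny|Ny] := pselect (N y); last first.
  have -> : \1_N y = 0 :> R by rewrite indicE memNset.
  rewrite !mul0r !addr0; congr (\1_A _).
  apply/fsetP => z; rewrite !inE/=; rewrite andb_idr// => zX.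
  apply/negP => /set_mem[xz Nz]; apply: Ny.
  rewrite (_ : y = z)//; apply: (hard_core_ball_uniq hX yX zX yx).
  exact/euclidean_ball_sym.
have -> : \1_N y = 1 :> R by rewrite indicE mem_set.
rewrite !mul1r addrC; congr (_ + \1_A _).
apply/fsetP => z; rewrite !inE/= andbC; apply: andb_id2r => zX.
apply/idP/idP => [/negP zN|/eqP zy].
  apply/eqP => zy; apply: zN; rewrite zy; apply/mem_set; split => //.
  exact/euclidean_ball_sym.
apply/negP => /set_mem[xz Nz]; apply: zy.
by apply: (hard_core_ball_uniq hX zX yX _ yx); exact/euclidean_ball_sym.
Qed.

(** The loss stands on the left and the gain on the right, so that no subtraction occurs. If the
    insertion is rejected, both indicators vanish, since [X] is already a packing. *)
Lemma local_insert_balance (X : config) x : packings r D X ->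
  h (local_step t N (X, (x, true))) +
    \1_[set y | [/\ D y, N y /\ A X & hard_core r (y |` X)%fset]] x =
  h X + \1_[set y | [/\ D y, N y /\ A (y |` X)%fset & hard_core r (y |` X)%fset]] x.
Proof.
move=> [XD hX]; rewrite /local_step.
have [[/set_mem Nx /set_mem[insD insH]]|nins] := pselect ((x \in N) /\
    (insert_center (X, x) \in packings r D)).
  rewrite ifT; last by apply/andP; split; apply/mem_set.
  have Dx : D x by apply: insD; rewrite !inE eqxx.
  rewrite addrC !indicE; congr (_%:R + _%:R); congr nat_of_bool.
    apply/idP/idP => /set_mem; first by case=> _ [_ AX] _; exact: mem_set.
    by move=> AX; apply/mem_set; split.
  apply/idP/idP => /set_mem; last by case=> _ [_ AX] _; exact: mem_set.
  by move=> AX; apply/mem_set; split.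
rewrite ifF; last by apply/negP => /andP.
have nadm (P : Prop) : ~ [/\ D x, N x /\ P & hard_core r (x |` X)%fset].
  move=> [Dx [Nx _] hx]; apply: nins; split; apply/mem_set => //; split => // z.
  by rewrite !inE => /orP[/eqP->|/XD].
by congr (_ + _); rewrite !indicE !memNset//; exact: nadm.
Qed.

Local Notation adm C X :=
  [set y | [/\ D y, C%classic (X, y) & hard_core r (y |` X)%fset]].

(** For an insertion the two sets test whether the state left, respectively the state reached, is in
    [A]. Evaluated at [X] minus [y], paired with [y], they describe the deletion of [y] from [X]
    with the roles exchanged. *)
Let before : set (config * E) := [set p | N p.2 /\ A p.1].
Let after : set (config * E) := [set p | N p.2 /\ A (insert_center p)].

Let mbefore : measurable before.
Proof.
rewrite (_ : before = A `*` N); first exact: measurableX.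
by apply/seteqP; split => p [].
Qed.

Let mafter : measurable after.
Proof.
rewrite (_ : after = (setT `*` N) `&` (@insert_center R d @^-1` A)).
  apply: measurableI; first exact: measurableX.
  exact: (measurable_preimage (@measurable_insert_center R d) mA).
by apply/seteqP; split => p; [case; split|case=> -[]].
Qed.

Let admE (C : set (config * E)) (X : config) : adm C X = xsection
  [set p : config * E | [/\ D p.2, C p & hard_core r (insert_center p)]] X.
Proof. by rewrite xsectionE. Qed.

Let measurable_adm (C : set (config * E)) (X : config) : measurable C -> measurable (adm C X).
Proof.
by move=> mC; rewrite admE; apply: measurable_xsection; exact: measurable_admissible.
Qed.

Let measurable_fun_adm (C : set (config * E)) : measurable C ->
  measurable_fun setT (fun X : config => leb (adm C X)).
Proof.
move=> mC; rewrite (_ : (fun X => _) = leb \o xsection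
  [set p : config * E | [/\ D p.2, C p & hard_core r (insert_center p)]]).
  by apply: measurable_fun_xsection; exact: measurable_admissible.
by apply/funext => X /=; rewrite admE.
Qed.

Let adm_sub (C : set (config * E)) (X : config) : C `<=` (setT `*` N) -> adm C X `<=` L1.
Proof.
move=> CN y [Dy /CN[_ Ny] _]; apply: (ball_sub Dy Ny).
by rewrite /euclidean_ball/= euclidean_distxx.
Qed.

Let beforeN : before `<=` setT `*` N. Proof. by move=> p []. Qed.
Let afterN : after `<=` setT `*` N. Proof. by move=> p []. Qed.

Lemma local_step_delete_integral (X : config) : packings r D X ->
  (\int[leb]_(x in L1) (h (local_step t N (X, (x, false))))%:E +
    (num_points [set y | after ((X `\ y)%fset, y)] X)%:R%:E =
   n%:E * (h X)%:E + (num_points [set y | before ((X `\ y)%fset, y)] X)%:R%:E)%E.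
Proof.
move=> [XD hX]; have mL := @region_measurable _ _ L1.
have ballL g y : y \in X -> \1_N y * g != 0 :> R -> euclidean_ball y r `<=` L1.
  move=> yX; have [Ny _|Ny] := pselect (N y); first exact: (ball_sub (XD _ yX) Ny).
  by rewrite indicE memNset// mul0r eqxx.
rewrite !num_pointsE.
under eq_big_seq => y yX.
  rewrite (_ : \1_ _ y = \1_N y * h X); last first.
    rewrite !indicE -natrM mulnb; congr (_%:R); congr nat_of_bool.
    apply/idP/andP => [/set_mem[/= Ny]|[/set_mem Ny /set_mem AX]].
      by rewrite /insert_center/= fsetD1K// => AX; split; exact: mem_set.
    by apply/mem_set; split => //; rewrite /insert_center/= fsetD1K.
  over.
under [X in _ = (_ + X%:E)%E]eq_bigr => y _.
  rewrite (_ : \1_ _ y = \1_N y * h (X `\ y)%fset); last first.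
    rewrite !indicE -natrM mulnb; congr (_%:R); congr nat_of_bool.
    apply/idP/andP => [/set_mem[/= Ny AX]|[/set_mem Ny /set_mem AX]].
      by split; exact: mem_set.
    by apply/mem_set; split.
  over.
rewrite -(@integral_ball_sum X (fun y => \1_N y * h X)); last 2 first.
- by move=> y; rewrite mulr_ge0.
- by move=> y; exact: ballL.
rewrite -(@integral_ball_sum X (fun y => \1_N y * h (X `\ y)%fset)); last 2 first.
- by move=> y; rewrite mulr_ge0.
- by move=> y; exact: ballL.
have mS (g : E -> R) : measurable_fun setT (fun x : E => \sum_(y <- X) \1_(euclidean_ball y r) x * g y).
  apply: measurable_sum => y; apply: measurable_funM; last exact: measurable_cst.
  by apply: measurable_indic; exact: measurable_euclidean_ball.
have mstep : measurable_fun setT (fun x : E => h (local_step t N (X, (x, false)))).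
  apply: (@measurableT_comp _ _ _ _ _ _ (\1_A : config -> R)); first exact: measurable_indic.
  apply: (measurableT_comp (@measurable_local_step R d r L t N mN)).
  by apply: measurable_fun_pair => //; exact: measurable_fun_pair.
have nE : (n%:E * (h X)%:E = \int[leb]_(x in L1) (h X)%:E)%E.
  by rewrite integral_cst//= region_volume_fin// muleC.
rewrite nE -!ge0_integralD//.
- apply: eq_integral => x _; rewrite -!EFinD; congr (_%:E).
  exact: local_delete_balance.
- by move=> x _; rewrite lee_fin; apply: sumr_ge0 => y _; rewrite !mulr_ge0.
- by apply/measurable_EFinP; apply: measurable_funTS; exact: mS.
- by apply/measurable_EFinP; exact: measurable_funTS.
- by move=> x _; rewrite lee_fin; apply: sumr_ge0 => y _; rewrite !mulr_ge0.
- by apply/measurable_EFinP; apply: measurable_funTS; exact: mS.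
Qed.

Lemma local_step_insert_integral (X : config) : packings r D X ->
  (\int[leb]_(x in L1) (h (local_step t N (X, (x, true))))%:E +
    leb (adm before X) =
   n%:E * (h X)%:E + leb (adm after X))%E.
Proof.
move=> XD; have mL := @region_measurable _ _ L1.
have lebE (C : set (config * E)) : measurable C -> C `<=` setT `*` N ->
    leb (adm C X) = (\int[leb]_(x in L1) (\1_(adm C X) x)%:E)%E.
  move=> mC CN; rewrite integral_indic//; last exact: measurable_adm.
  by rewrite setIidl//; exact: adm_sub.
rewrite !lebE//.
have mstep : measurable_fun setT (fun x : E => h (local_step t N (X, (x, true)))).
  apply: (@measurableT_comp _ _ _ _ _ _ (\1_A : config -> R)); first exact: measurable_indic.
  apply: (measurableT_comp (@measurable_local_step R d r L t N mN)).
  by apply: measurable_fun_pair => //; exact: measurable_fun_pair.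
have nE : (n%:E * (h X)%:E = \int[leb]_(x in L1) (h X)%:E)%E.
  by rewrite integral_cst//= region_volume_fin// muleC.
rewrite nE -!ge0_integralD//.
- apply: eq_integral => x _; rewrite -!EFinD; congr (_%:E).
  exact: local_insert_balance.
- by apply/measurable_EFinP; apply: measurable_indic; exact: measurable_adm.
- by apply/measurable_EFinP; exact: measurable_funTS.
- by apply/measurable_EFinP; apply: measurable_indic; exact: measurable_adm.
Qed.

(* By the Mecke identity the expected loss by deletions is the expected gain by
   insertions, and conversely. *)
Lemma hard_sphere_stationary_event :
  (hs \x update_choice lam L1)%E (@local_step R d r L t N @^-1` A) = hs A.
Proof.
have mL := @region_measurable _ _ L1.
have mp : measurable (packings r D) by apply: measurable_packings; exact: measurable_centers.
have mst := @measurable_local_step R d r L t N mN.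
have mpre : measurable (@local_step R d r L t N @^-1` A) by exact: measurable_preimage.
have mhA : measurable_fun setT (fun X : config => (h X)%:E).
  by apply/measurable_EFinP; exact: measurable_indic.
have mf : measurable_fun setT (fun p : config * (E * bool) => (h (local_step t N p))%:E).
  exact: (measurableT_comp mhA mst).
pose k := (1 + lam%:num) * n.
have k_gt0 : 0 < k by rewrite mulr_gt0// region_volume_fine_gt0.
pose U (X : config) := (\int[update_choice lam L1]_u (h (local_step t N (X, u)))%:E)%E.
have mU : measurable_fun setT U.
  exact: (measurable_fun_fubini_tonelli_F (fun p : config * (E * bool) => (h (local_step t N p))%:E)).
have U0 X : (0 <= U X)%E by apply: integral_ge0 => u _; rewrite lee_fin.
have -> : (hs \x update_choice lam L1)%E (@local_step R d r L t N @^-1` A) = (\int[hs]_X U X)%E.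
  transitivity (\int[(hs \x update_choice lam L1)%E]_p (h (local_step t N p))%:E)%E.
    transitivity (\int[(hs \x update_choice lam L1)%E]_p
        (\1_(@local_step R d r L t N @^-1` A) p)%:E)%E => //.
    by rewrite (integral_indicT _ mpre).
  rewrite (fubini_tonelli1 (fun p : config * (E * bool) => (h (local_step t N p))%:E))//.
(* [P] is the total rate of the moves that start in [A], [Q] of those that end in [A]; moves doing
   both appear in both. *)
pose P (X : config) := (lam%:num%:E * leb (adm before X) +
  (num_points [set y | after ((X `\ y)%fset, y)] X)%:R%:E)%E.
pose Q (X : config) := (lam%:num%:E * leb (adm after X) +
  (num_points [set y | before ((X `\ y)%fset, y)] X)%:R%:E)%E.
have m1 := measurable_fun_adm mbefore; have m2 := measurable_fun_adm mafter.
have m3 : measurable_fun setT (fun X : config => (num_points [set y | before ((X `\ y)%fset, y)] X)%:R%:E : \bar R).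
  by apply/measurable_EFinP; exact: measurable_num_removed.
have m4 : measurable_fun setT (fun X : config => (num_points [set y | after ((X `\ y)%fset, y)] X)%:R%:E : \bar R).
  by apply/measurable_EFinP; exact: measurable_num_removed.
have mP : measurable_fun setT P by apply: emeasurable_funD => //; exact: measurable_funeM.
have mQ : measurable_fun setT Q by apply: emeasurable_funD => //; exact: measurable_funeM.
have l0 : (0 <= lam%:num%:E :> \bar R)%E by rewrite lee_fin.
have P0 X : (0 <= P X)%E by apply: adde_ge0; [exact: mule_ge0|rewrite lee_fin].
have Q0 X : (0 <= Q X)%E by apply: adde_ge0; [exact: mule_ge0|rewrite lee_fin].
have balance X : packings r D X -> (k%:E * U X + P X = k%:E * (h X)%:E + Q X)%E.
  move=> XD; rewrite /U ge0_integral_update_choice//; last first.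
    exact: (measurableT_comp mf (pair1_measurable X)).
  rewrite muleA -EFinM divff ?gt_eqF// mul1e.
  have I0 : (0 <= \int[leb]_(x in L1) (h (local_step t N (X, (x, true))))%:E)%E.
    by apply: integral_ge0 => x _; rewrite lee_fin.
  rewrite /P addeACA -ge0_muleDr// local_step_delete_integral//.
  rewrite local_step_insert_integral// ge0_muleDr//; last first.
    by rewrite -EFinM lee_fin mulr_ge0// fine_ge0.
  rewrite addeACA; congr (_ + _)%E; rewrite -!EFinM -EFinD; congr (_%:E).
  by rewrite /k mulrDl mul1r [RHS]mulrDl addrC mulrA.
(* The Mecke identity turns the insertion term of each of [P] and [Q] into the deletion term of the
   other. *)
have intP : (\int[hs]_X P X = \int[hs]_X Q X)%E.
  rewrite !ge0_integralD//; try by [exact: measurable_funeM|move=> X _; exact: mule_ge0].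
  rewrite !ge0_integralZl//.
  rewrite !(hard_sphere_mecke d_gt0 lam t)//.
  by rewrite addeC.
have bound (C : set (config * E)) : measurable C -> C `<=` setT `*` N ->
    (\int[hs]_X leb (adm C X) < +oo)%E.
  move=> mC CN; apply: (@le_lt_trans _ _ (\int[hs]_X n%:E)%E); last first.
    rewrite integral_cst// [X in (_ * X)%E](_ : _ = 1%E) ?mule1 ?ltry//.
    exact: probability_setT.
  apply: ge0_le_integral => //; first exact: measurable_fun_adm.
  move=> X _; rewrite -region_volume_fin; apply: le_measure; rewrite ?inE//.
    exact: measurable_adm.
  exact: adm_sub.
(* Finiteness allows this integral to be cancelled from the integrated balance, an equation between
   extended reals. *)
have Pfin : (\int[hs]_X P X)%E \is a fin_num.
  rewrite ge0_fin_numE; last by apply: integral_ge0.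
  rewrite ge0_integralD//; try by [exact: measurable_funeM|move=> X _; exact: mule_ge0].
  rewrite !ge0_integralZl// (hard_sphere_mecke d_gt0 lam t)//.
  by apply: lte_add_pinfty; apply: lte_mul_pinfty => //; exact: bound.
clearbody P Q U.
have : (\int[hs]_X (k%:E * U X + P X) = \int[hs]_X (k%:E * (h X)%:E + Q X))%E.
  apply: ge0_ae_eq_integral => //.
  - by apply: emeasurable_funD => //; exact: measurable_funeM.
  - by apply: emeasurable_funD => //; exact: measurable_funeM.
  - by move=> X _; apply: adde_ge0 => //; apply: mule_ge0 => //; rewrite lee_fin ltW.
  - by move=> X _; apply: adde_ge0 => //; apply: mule_ge0 => //; rewrite lee_fin// ltW.
  apply: filterS (ae_probability1 mp (hard_sphere_packings d_gt0 lam t)) => X XD _.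
  exact: balance.
have k0 : (0 <= k%:E)%E by rewrite lee_fin ltW.
rewrite !ge0_integralD//; try by [exact: measurable_funeM|move=> X _; exact: mule_ge0].
rewrite !ge0_integralZl// -intP => /(congr1 (fun x => x - \int[hs]_X P X)%E).
rewrite !addeK//.
move=> /(congr1 (fun x => (k^-1)%:E * x)%E).
rewrite !muleA -EFinM mulVf ?gt_eqF// !mul1e => ->.
by rewrite integral_indic// setIT.
Qed.

End stationarity.

(** * Coupling of the restricted dynamics with the single-center dynamics *)

Section marginals.
Context d1 d2 d3 (S : measurableType d1) (Z : measurableType d2)
  (V : measurableType d3) (R : realType).
Variables (Q : probability S R) (P : probability Z R) (U : probability V R).
Variables (pi : S -> Z) (mpi : measurable_fun setT pi).
Hypothesis PQ : forall A, measurable A -> Q (pi @^-1` A) = P A.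
Local Open Scope ereal_scope.

Lemma ge0_integral_marginal (f : Z -> \bar R) :
  measurable_fun setT f -> (forall z, 0 <= f z) ->
  \int[Q]_s f (pi s) = \int[P]_z f z.
Proof.
move=> mf f0; transitivity (\int[pushforward Q pi]_z f z).
  by rewrite (ge0_integral_pushforward mpi)// preimage_setT.
pose mixin := isMeasurableFun.Build _ _ _ _ pi mpi.
pose ppi : {mfun S >-> Z} := HB.pack pi mixin.
apply: (@eq_measure_integral _ _ _ _ P (pushforward Q ppi)).
by move=> A mA _; exact: PQ.
Qed.

(** The input of a step is independent of the coupled state, so one coordinate together with the
    input has the product law of its own chain. This preserves the marginals of the coupling from
    step to step. *)
Lemma product_marginal (B : set (Z * V)) : measurable B ->
  (Q \x U) ((fun q => (pi q.1, q.2)) @^-1` B) = (P \x U) B.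
Proof.
move=> mB; transitivity (\int[Q]_s (U \o xsection B) (pi s)).
  apply: eq_integral => s _ /=; congr (U _).
rewrite (ge0_integral_marginal (f := U \o xsection B))//.
exact: measurable_fun_xsection.
Qed.

End marginals.

Section discrepancy.
Context (R : realType) (d : nat).
Local Notation E := 'rV[R]_d.
Local Notation config := (config R d).

Definition discrepancy (p : config * config) : config :=
  ((p.1 `\` p.2) `|` (p.2 `\` p.1))%fset.

Lemma in_discrepancy p y :
  (y \in discrepancy p) = (y \in p.1) (+) (y \in p.2).
Proof. by rewrite !inE; case: (y \in p.1); case: (y \in p.2). Qed.

Lemma num_pointsU (A : set E) (X Y : config) : [disjoint X & Y]%fset ->
  num_points A (X `|` Y)%fset = (num_points A X + num_points A Y)%N.
Proof.
move=> XY; rewrite /num_points.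
rewrite (_ : [fset x in (X `|` Y)%fset | x \in A]%fset =
  ([fset x in X | x \in A] `|` [fset x in Y | x \in A])%fset); last first.
  by apply/fsetP => y; rewrite !inE/= andb_orl.
rewrite cardfsU [X in (_ - X)%N](_ : _ = 0%N) ?subn0//.
apply/eqP; rewrite cardfs_eq0; apply/eqP/fsetP => y; rewrite !inE/=.
apply/negP => /andP[/andP[yX _] /andP[yY _]].
by move/fdisjointP : XY => /(_ _ yX); rewrite yY.
Qed.

Lemma measurable_discrepancy : measurable_fun setT discrepancy.
Proof.
apply: measurable_config_fun => A mA.
pose C := ~` [set p : config * E | p.2 \in p.1] `&` (setT `*` A).
have mC : measurable C.
  apply: measurableI; last exact: measurableX.
  by apply: measurableC; exact: measurable_mem_config.
have m := @measurable_num_points_section R d _ config C mC.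
have ms : measurable_fun setT (fun p : config * config => (p.2, p.1)).
  exact: measurable_swap.
rewrite (_ : (fun t => _) = (fun p : config * config =>
    (num_points [set y | C (p.2, y)] p.1)%:R + (num_points [set y | C (p.1, y)] p.2)%:R)).
  by apply: measurable_funD => //; exact: (measurableT_comp m ms).
apply/funext => -[X Y]; rewrite /discrepancy/= num_pointsU; last first.
  by apply/fdisjointP => y; rewrite !inE => /andP[/negPf -> _]; rewrite andbF.
rewrite natrD; congr (_%:R + _%:R); rewrite /num_points; congr (#|` _|).
  apply/fsetP => y; rewrite !inE/= -andbA andbCA; congr andb.
  apply/andP/idP => [[/negP yY /set_mem Ay]|/set_mem[yY [_ Ay]]].
    by apply/mem_set; split.
  by split; [exact/negP|exact: mem_set].
apply/fsetP => y; rewrite !inE/= -andbA andbCA; congr andb.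
apply/andP/idP => [[/negP yY /set_mem Ay]|/set_mem[yY [_ Ay]]].
  by apply/mem_set; split.
by split; [exact/negP|exact: mem_set].
Qed.

Lemma num_points_le (A B : set E) (X Y : config) :
  (forall y, y \in X -> A y -> y \in Y /\ B y) ->
  (num_points A X <= num_points B Y)%N.
Proof.
move=> XY; apply: fsubset_leq_card; apply/fsubsetP => y; rewrite !inE/=.
by move=> /andP[yX /set_mem /(XY _ yX)[-> By]] /=; exact: mem_set.
Qed.

Lemma num_points_leS (A B : set E) (X Y : config) x :
  (forall y, y \in X -> A y -> (y \in Y /\ B y) \/ y = x) ->
  (num_points A X <= (num_points B Y).+1)%N.
Proof.
move=> XY; rewrite -add1n.
apply: (@leq_trans #|` x |` [fset y in Y | y \in B]|%fset); last first.
  by rewrite cardfsU1 leq_add2r; case: (_ \notin _).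
apply: fsubset_leq_card; apply/fsubsetP => y; rewrite !inE/=.
move=> /andP[yX /set_mem /(XY _ yX)[[-> By]|->]]; last by rewrite eqxx.
by rewrite mem_set ?orbT.
Qed.

End discrepancy.

Lemma packings_insert (R : realType) (d : nat) (r : R) (C : set 'rV[R]_d)
    (X : config R d) x : packings r C X -> C x ->
  (forall y, y \in X -> y != x -> 2 * r <= euclidean_dist x y) ->
  packings r C (x |` X)%fset.
Proof.
move=> [XC hX] Cx far; split => [y|y z]; rewrite !inE.
  by move=> /orP[/eqP->|/XC].
move=> /orP[/eqP->|yX] /orP[/eqP->|zX] yz.
- by rewrite eqxx in yz.
- by apply: far => //; rewrite eq_sym.
- by rewrite euclidean_distC; exact: far.
- exact: hX.
Qed.

Section coupling.
Context (R : realType) (d : nat) (d_gt0 : (0 < d)%N) (r : R) (lam : {posnum R}).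
Local Notation E := 'rV[R]_d.
Local Notation config := (config R d).
Hypothesis r_gt0 : 0 < r.
Hypothesis r_unit_ball : lebesgue_rV (euclidean_ball (0 : E) r) = 1%E.
Variables (L : region R d) (t : boundary_condition r L).
Variables (L1 : region R d) (t1 : boundary_condition r L1).
Local Notation D := (centers t).
Local Notation W := (centers t1).
Variables (K : nat) (A : nat -> set E) (mA : forall k, measurable (A k)).
Local Notation N := (A K).
Hypothesis A_next : forall k x y, A k x -> euclidean_dist x y < 2 * r -> A k.+1 y.
Hypothesis WE : W = D `&` N.
Hypothesis L1_gt0 : (0 < lebesgue_rV L1)%E.
Local Notation n1 := (fine (lebesgue_rV L1)).
Local Notation hs := (hard_sphere lam t).
Local Notation leb := (@lebesgue_rV R d).

Let mN : measurable N := mA K.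

Lemma level_subset k l : (k <= l)%N -> A k `<=` A l.
Proof.
move=> /subnK <-; elim: (l - k)%N => [//|i ih] x /ih Ax.
by apply: A_next Ax _; rewrite euclidean_distxx mulr_gt0.
Qed.

Definition joint_step (p : (config * config) * (E * bool)) : config * config :=
  (local_step t N (p.1.1, p.2), single_center_step t1 (p.1.2, p.2)).

Lemma measurable_joint_step : measurable_fun setT joint_step.
Proof.
apply: measurable_fun_pair.
  apply: (measurableT_comp (@measurable_local_step R d r L t N mN)).
  apply: measurable_fun_pair => //.
  exact: (measurableT_comp measurable_fst measurable_fst).
apply: (measurableT_comp (measurable_single_center_step t1)).
apply: measurable_fun_pair => //.
exact: (measurableT_comp measurable_snd measurable_fst).
Qed.

HB.instance Definition _ := isMeasurableFun.Build _ _ _ _ joint_step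
  measurable_joint_step.

Definition joint_start (X : config) : config * config := (X, restrict_config N X).

Lemma measurable_joint_start : measurable_fun setT joint_start.
Proof. by apply: measurable_fun_pair => //; exact: measurable_restrict_config. Qed.

HB.instance Definition _ := isMeasurableFun.Build _ _ _ _ joint_start
  measurable_joint_start.

HB.instance Definition _ := isMeasurableFun.Build _ _ _ _ (restrict_config N)
  (measurable_restrict_config mN).

Definition local_start : probability config R :=
  distribution hs (restrict_config N).

Definition joint_law (m : nat) : probability (config * config)%type R :=
  iter m (fun Q : probability (config * config)%type R =>
    distribution (Q \x update_choice lam L1)%E joint_step)
    (distribution hs joint_start).


Hypothesis ball_sub : forall y, D y -> N y -> euclidean_ball y r `<=` L1.

Lemma joint_law_fst m (B : set config) : measurable B ->
  joint_law m (fst @^-1` B) = hs B.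
Proof.
elim: m B => [|m ih] B mB.
  by transitivity (hs (joint_start @^-1` (fst @^-1` B))).
have mB' : measurable (@local_step R d r L t N @^-1` B).
  exact: (measurable_preimage (@measurable_local_step R d r L t N mN)).
rewrite -(hard_sphere_stationary_event d_gt0 lam r_gt0 r_unit_ball mN L1_gt0 ball_sub mB).
rewrite -(product_marginal (update_choice lam L1) measurable_fst ih mB').
by [].
Qed.

Lemma joint_law_snd m (B : set config) : measurable B ->
  joint_law m (snd @^-1` B) = law_at t1 lam local_start m B.
Proof.
elim: m B => [|m ih] B mB.
  by transitivity (hs (joint_start @^-1` (snd @^-1` B))).
have mB' : measurable (@single_center_step R d r L1 t1 @^-1` B).
  exact: (measurable_preimage (@measurable_single_center_step R d r L1 t1)).
transitivity ((law_at t1 lam local_start m \x update_choice lam L1)%E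
  (@single_center_step R d r L1 t1 @^-1` B)); last by [].
rewrite -(product_marginal (update_choice lam L1) measurable_snd ih mB').
by [].
Qed.

Lemma single_center_step_packings (p : config * (E * bool)) :
  packings r W p.1 -> packings r W (single_center_step t1 p).
Proof.
case: p => X [x []] /= XW; first by case: ifPn => // /set_mem.
split => [y|]; first by rewrite !inE/= => /andP[/XW.1].
by apply: hard_core_sub XW.2 _ => y; rewrite !inE/= => /andP[].
Qed.

Lemma measurable_local_packings : measurable (packings r W).
Proof. by apply: measurable_packings; exact: measurable_centers. Qed.

Lemma local_start_packings : local_start (packings r W) = 1%E.
Proof.
apply/eqP; rewrite eq_le probability_le1/=; last exact: measurable_local_packings.
rewrite -(hard_sphere_packings d_gt0 lam t); apply: le_measure; rewrite ?inE.
- by apply: measurable_packings; exact: measurable_centers.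
- exact: (measurable_preimage (measurable_restrict_config mN) measurable_local_packings).
move=> X [XD hX]; split => [y|].
  by rewrite !inE/= => /andP[/XD Dy /set_mem Ny]; rewrite WE.
by apply: hard_core_sub hX _ => y; rewrite !inE/= => /andP[].
Qed.

Lemma law_at_packings (mu0 : probability config R) m :
  mu0 (packings r W) = 1%E -> law_at t1 lam mu0 m (packings r W) = 1%E.
Proof.
move=> mu01; elim: m => [//|m ih].
have mW := measurable_local_packings.
apply/eqP; rewrite eq_le probability_le1//=.
have <- : (law_at t1 lam mu0 m \x update_choice lam L1)%E (packings r W `*` setT) = 1%E.
  by rewrite product_measure1E// -[RHS]mule1; congr (_ * _)%E => //; exact: probability_setT.
apply: le_measure; rewrite ?inE.
- exact: measurableX.
- exact: (measurable_preimage (@measurable_single_center_step R d r L1 t1)).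
by move=> p [/= pW _]; exact: single_center_step_packings.
Qed.

Lemma ae_joint_packings m :
  {ae joint_law m, forall p, packings r D p.1 /\ packings r W p.2}.
Proof.
have mD : measurable (packings r D) by apply: measurable_packings; exact: measurable_centers.
have mW := measurable_local_packings.
have a1 : {ae joint_law m, forall p : config * config, packings r D p.1}.
  apply: (@ae_probability1 _ _ _ _ (fst @^-1` packings r D)).
    exact: (measurable_preimage measurable_fst).
  by apply: (etrans (joint_law_fst m mD)); exact: hard_sphere_packings.
have a2 : {ae joint_law m, forall p : config * config, packings r W p.2}.
  apply: (@ae_probability1 _ _ _ _ (snd @^-1` packings r W)).
    exact: (measurable_preimage measurable_snd).
  apply: (etrans (joint_law_snd m mW)); apply: law_at_packings.
  exact: local_start_packings.
by apply: filterS2 a1 a2.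
Qed.

(* An insertion at x accepted by exactly one of the chains is blocked in the other
   one by a center within 2r of x, which only that chain has. *)
Lemma joint_step_discrepancy k (p : config * config) x b : (k < K)%N ->
  packings r D p.1 -> packings r W p.2 ->
  (num_points (A k) (discrepancy (joint_step (p, (x, b)))) <=
   num_points (A k) (discrepancy p) +
   num_points [set y | A k.+1 y /\ euclidean_ball y (2 * r) x] (discrepancy p))%N.
Proof.
case: p => X Y kK [XD hX] [YW hY]; have AkN y : A k y -> N y by apply: level_subset; exact: ltnW.
(* Inside [A k], a subset of [N], both chains delete at the same places, so a deletion creates no
   discrepancy. *)
case: b; last first.
  rewrite -[leqLHS]addn0 leq_add//; apply: num_points_le => y yd Ay; split => //.
  move: yd; rewrite !in_discrepancy /joint_step /= /local_delete /delete_ball !inE/=.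
  have -> : (y \in euclidean_ball x r `&` N) = (y \in euclidean_ball x r).
    by apply/idP/idP => /set_mem h; apply/mem_set; [case: h|split => //; exact: AkN].
  by case: (y \in X); case: (y \in Y); case: (y \in euclidean_ball x r).
set S := num_points [set y | _] _.
have acceptX : local_step t N (X, (x, true)) =
    if (x \in N) && (insert_center (X, x) \in packings r D) then (x |` X)%fset else X by [].
have acceptY : single_center_step t1 (Y, (x, true)) =
    if insert_center (Y, x) \in packings r W then (x |` Y)%fset else Y by [].
have -> : joint_step ((X, Y), (x, true)) =
  (local_step t N (X, (x, true)), single_center_step t1 (Y, (x, true))) by [].
rewrite acceptX acceptY; set PX := (_ && _); set PY := (_ \in packings r W).
have xS y : y \in discrepancy (X, Y) -> euclidean_dist x y < 2 * r -> A k x -> (0 < S)%N.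
  move=> yXY xy Ax; apply/num_points_gt0; exists y => //; split; first exact: A_next Ax xy.
  exact/euclidean_ball_sym.
have [same|diff] := eqVneq PX PY.
  rewrite same -[leqLHS]addn0 leq_add//; apply: num_points_le => y yd Ay; split => //.
  move: yd; rewrite !in_discrepancy /=; case: (PY) => //=; rewrite !inE.
  by case: (y == x).
have [Ax|nAx] := pselect (A k x); last first.
  rewrite -[leqLHS]addn0 leq_add//; apply: num_points_le => y yd Ay; split => //.
  have yx : (y == x) = false by apply/eqP => yx; apply: nAx; rewrite -yx.
  move: yd; rewrite !in_discrepancy /=.
  by case: (PX); case: (PY) => /=; rewrite ?inE ?yx.
have S0 : (0 < S)%N.
  have clash (C : set E) (Z : config) : packings r C Z -> C x ->
      ~ packings r C (x |` Z)%fset -> exists2 y, y \in Z /\ y != x & euclidean_dist x y < 2 * r.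
    move=> CZ Cx nZ; apply: contrapT => ny; apply: nZ; apply: packings_insert => // y yZ yx.
    by rewrite leNgt; apply/negP => xy; apply: ny; exists y.
  have nearby (Z Z' : config) y : hard_core r (x |` Z')%fset -> y != x ->
      euclidean_dist x y < 2 * r -> y \notin Z'.
    move=> hZ' yx xy; apply/negP => yZ'; have := hZ' x y; rewrite !inE eqxx yZ' orbT.
    by move=> /(_ isT isT); rewrite eq_sym => /(_ yx); rewrite leNgt xy.
  case: (boolP PX) diff => [PXt|PXf] diff.
    have /andP[/set_mem Nx /set_mem[insD insH]] := PXt.
    have Dx : D x by apply: insD; rewrite !inE eqxx.
    have nY : ~ packings r W (x |` Y)%fset.
      by move=> pY; move: diff; rewrite /PY mem_set.
    have Wx : W x by rewrite WE.
    have [y [yY yx] xy] := clash W Y (conj YW hY) Wx nY.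
    by apply: (xS y) => //; rewrite in_discrepancy/= yY (negPf (nearby X X y insH yx xy)).
  have PYt : PY by move: diff; case: (PY).
  have /set_mem[insW insH] := PYt.
  have Wx : W x by apply: insW; rewrite !inE eqxx.
  have [Dx Nx] : D x /\ N x by move: Wx; rewrite WE => -[].
  have nX : ~ packings r D (x |` X)%fset.
    by move=> pX; move/negP : PXf; apply; apply/andP; split; exact: mem_set.
  have [y [yX yx] xy] := clash D X (conj XD hX) Dx nX.
  by apply: (xS y) => //; rewrite in_discrepancy/= yX (negPf (nearby Y Y y insH yx xy)).
apply: (@leq_trans (num_points (A k) (discrepancy (X, Y))).+1); last first.
  by rewrite -addn1 leq_add2l.
apply: num_points_leS => y yd Ay; have [->|yx] := eqVneq y x; [by right|left].
split => //; move: yd; rewrite !in_discrepancy /=.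
by case: (PX); case: (PY) => /=; rewrite ?inE ?(negPf yx).
Qed.

Local Notation count k p := (num_points (A k) (discrepancy p)).

Lemma measurable_count k : measurable_fun setT (fun p : config * config => (count k p)%:R : R).
Proof.
exact: (measurableT_comp (measurable_num_points (mA k)) (@measurable_discrepancy R d)).
Qed.

Variable V : R.
Hypothesis V_ball : (leb (euclidean_ball (0 : E) (2 * r)) <= V%:E)%E.

(** Exchange the integral and the sum over the points: the locations within [2 * r] of one point
    have volume at most [V]. *)
Lemma integral_near_discrepancy k (X : config) :
  (\int[leb]_(x in L1)
     (num_points [set y | A k y /\ euclidean_ball y (2 * r) x] X)%:R%:E <=
   V%:E * (num_points (A k) X)%:R%:E)%E.
Proof.
have mL := @region_measurable _ _ L1.
have mb (y : E) := measurable_euclidean_ball y (2 * r).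
under eq_integral => x _.
  rewrite num_pointsE -sumEFin.
  under eq_bigr => y _.
    rewrite (_ : \1_ _ y = \1_(A k) y * \1_(euclidean_ball y (2 * r)) x); last first.
      rewrite !indicE -natrM mulnb; congr (_%:R); congr nat_of_bool.
      apply/idP/andP => [/set_mem[Ay yx]|[/set_mem Ay /set_mem yx]].
        by split; exact: mem_set.
      by apply/mem_set; split.
    rewrite EFinM; over.
  over.
rewrite ge0_integral_sum//; last first.
  move=> y; apply: measurable_funeM; apply/measurable_EFinP.
  exact: measurable_indic.
rewrite num_pointsE -sumEFin ge0_sume_distrr; last by move=> y _; rewrite lee_fin.
apply: lee_sum => y _; rewrite ge0_integralZl//; last first.
  by apply/measurable_EFinP; exact: measurable_indic.
rewrite muleC; apply: lee_wpmul2r; first by rewrite lee_fin.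
rewrite integral_indic//; apply: le_trans V_ball.
rewrite -(lebesgue_euclidean_ball y); apply: le_measure; rewrite ?inE//.
exact: measurableI.
Qed.

(** The bound of [joint_step_discrepancy] does not look at the coin, so the branches of weight [lam]
    and 1 add up and the factor [1 + lam] cancels. *)
Lemma joint_step_mean k (p : config * config) : (k < K)%N ->
  packings r D p.1 -> packings r W p.2 ->
  (\int[update_choice lam L1]_u (count k (joint_step (p, u)))%:R%:E <=
   (count k p)%:R%:E + (V / n1)%:E * (count k.+1 p)%:R%:E)%E.
Proof.
move=> kK pD pW; have mL := @region_measurable _ _ L1.
pose g (x : E) : \bar R := ((count k p)%:R%:E +
  (num_points [set y | A k.+1 y /\ euclidean_ball y (2 * r) x] (discrepancy p))%:R%:E)%E.
have mnear : measurable_fun setT (fun x : E =>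
    (num_points [set y | A k.+1 y /\ euclidean_ball y (2 * r) x] (discrepancy p))%:R : R).
  pose C := [set q : E * E | euclidean_dist q.1 q.2 < 2 * r] `&` (setT `*` A k.+1).
  have mC : measurable C.
    by apply: measurableI; [exact: measurable_close|exact: measurableX].
  have := measurableT_comp (@measurable_num_points_section R d _ E C mC)
    (pair2_measurable (discrepancy p)).
  apply: eq_measurable_fun => x _ /=; congr (num_points _ _)%:R.
  apply/seteqP; split => y /=; first by move=> [/euclidean_ball_sym xy [_ Ay]].
  by move=> [Ay /euclidean_ball_sym xy].
have mg : measurable_fun setT g.
  by apply: emeasurable_funD => //; apply/measurable_EFinP.
have g0 x : (0 <= g x)%E by apply: adde_ge0; rewrite lee_fin.
apply: (@le_trans _ _ (\int[update_choice lam L1]_u g u.1)%E).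
  apply: ge0_le_integral => //.
  - apply/measurable_EFinP; apply: (measurableT_comp (measurable_count k)).
    exact: (measurableT_comp measurable_joint_step (pair1_measurable p)).
  - exact: (measurableT_comp mg measurable_fst).
  - move=> [x b] _; rewrite /g -EFinD lee_fin -natrD ler_nat.
    exact: joint_step_discrepancy.
rewrite ge0_integral_update_choice//; last exact: (measurableT_comp mg measurable_fst).
rewrite /=; set G := (\int[_]_(x in _) g x)%E.
have G0 : (0 <= G)%E by apply: integral_ge0.
have GE : (G <= n1%:E * (count k p)%:R%:E + V%:E * (count k.+1 p)%:R%:E)%E.
  rewrite /G /g ge0_integralD//; last first.
    by apply/measurable_EFinP; exact: measurable_funTS.
  rewrite leeD//; last exact: integral_near_discrepancy.
  by rewrite integral_cst//= region_volume_fin// muleC.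
have n0 := region_volume_fine_gt0 L1_gt0.
have l0 : 0 < 1 + lam%:num by rewrite addr_gt0.
rewrite -[X in (_ * (_ + X))%E]mul1e -ge0_muleDl// muleA -EFinD -EFinM.
rewrite invfM mulrC mulrA [lam%:num + 1]addrC divff ?gt_eqF// mul1r.
apply: (le_trans (lee_wpmul2l _ GE)); first by rewrite lee_fin invr_ge0 ltW.
rewrite -!EFinM -!EFinD lee_fin mulrDr mulKf ?gt_eqF// lerD2l.
by rewrite mulrA (mulrC _ V).
Qed.

Let count_mean k m : \bar R := (\int[joint_law m]_p (count k p)%:R%:E)%E.

Lemma count_meanS k m : (k < K)%N ->
  (count_mean k m.+1 <= count_mean k m + (V / n1)%:E * count_mean k.+1 m)%E.
Proof.
move=> kK; rewrite /count_mean.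
have mc l : measurable_fun setT (fun p : config * config => (count l p)%:R%:E : \bar R).
  by apply/measurable_EFinP; exact: measurable_count.
have mcj : measurable_fun setT (fun q : (config * config) * (E * bool) => (count k (joint_step q))%:R%:E : \bar R).
  exact: (measurableT_comp (mc k) measurable_joint_step).
have V0 : 0 <= V / n1.
  rewrite divr_ge0 ?fine_ge0// -lee_fin; exact: le_trans V_ball.
rewrite -ge0_integralZl//.
rewrite -ge0_integralD//; last 2 first.
- by move=> p _; apply: mule_ge0; rewrite lee_fin.
- exact: measurable_funeM.
have -> : (\int[joint_law m.+1]_p (count k p)%:R%:E =
    \int[(joint_law m \x update_choice lam L1)%E]_q (count k (joint_step q))%:R%:E)%E.
  by rewrite [LHS](ge0_integral_pushforward measurable_joint_step)// preimage_setT.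
rewrite (fubini_tonelli1 (fun q : (config * config) * (E * bool) => (count k (joint_step q))%:R%:E))//.
apply: ae_ge0_le_integral => //.
- by move=> p _; apply: integral_ge0 => u _; rewrite lee_fin.
- apply: (measurable_fun_fubini_tonelli_F (fun q : (config * config) * (E * bool) => (count k (joint_step q))%:R%:E)) => //.
- by move=> p _; apply: adde_ge0; rewrite ?mule_ge0 ?lee_fin.
- by apply: emeasurable_funD => //; exact: measurable_funeM.
apply: filterS (ae_joint_packings m) => p [pD pW] _.
exact: joint_step_mean.
Qed.

Lemma count_mean_start k : (k <= K)%N -> count_mean k 0 = 0%E.
Proof.
move=> kK; have mc : measurable_fun setT (fun p : config * config => (count k p)%:R%:E : \bar R).
  by apply/measurable_EFinP; exact: measurable_count.
rewrite /count_mean [LHS](ge0_integral_pushforward measurable_joint_start)// preimage_setT.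
apply: integral0_eq => X _ /=; rewrite (_ : count k _ = 0%N)//.
apply/eqP; rewrite -leqn0 leqNgt; apply/negP => /num_points_gt0[y].
rewrite in_discrepancy /= !inE/= => + /(level_subset kK) Ny.
by rewrite (mem_set Ny) andbT; case: (y \in X).
Qed.

(** Level [K] anchors the induction. Its discrepancies may be caused by centers just outside [N], to
    which the recursion does not reach; they are bounded only by the numbers of points of two
    packings of the window. *)
Lemma count_mean_top m : (count_mean K m <= (2 * n1)%:E)%E.
Proof.
have mc : measurable_fun setT (fun p : config * config => (count K p)%:R%:E : \bar R).
  by apply/measurable_EFinP; exact: measurable_count.
apply: (@le_trans _ _ (\int[joint_law m]_p (2 * n1)%:E)%E); last first.
  rewrite integral_cst// [X in (_ * X)%E](_ : _ = 1%E) ?mule1//.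
  exact: probability_setT.
apply: ae_ge0_le_integral => //.
- by move=> p _; rewrite lee_fin mulr_ge0// fine_ge0.
apply: filterS (ae_joint_packings m) => p [pD pW] _.
have WL : W `<=` r_interior r L1 by move=> y [].
have vol (Z : config) : packings r W Z -> (#|` Z|%:R <= n1).
  move=> [ZW hZ]; rewrite -lee_fin -region_volume_fin.
  apply: (packing_volume r_unit_ball (@region_measurable _ _ L1)).
  by split => // y /ZW /WL.
(* Only the part of the first configuration in [N] is counted, and its points are admissible centers
   of the window. *)
have pN : packings r W [fset y in p.1 | y \in N]%fset.
  split; first by move=> y; rewrite !inE/= => /andP[/pD.1 Dy /set_mem Ny]; rewrite WE.
  by apply: hard_core_sub pD.2 _ => y; rewrite !inE/= => /andP[].
rewrite lee_fin mulr_natl mulr2n.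
apply: le_trans (lerD (vol _ pN) (vol _ pW)); rewrite -natrD ler_nat.
apply: leq_trans (leq_card_fsetU _ _); apply: fsubset_leq_card.
apply/fsubsetP => y; rewrite !inE/=.
by case: (y \in N); case: (y \in p.1); case: (y \in p.2).
Qed.

(* The weights exp(- (K - k)) turn the recursion of [count_meanS] into a
   multiplication by 1 + e V / n at each step. *)
Lemma count_mean_decay k m : (k <= K)%N ->
  (count_mean k m <= (2 * n1 * expR (- (K - k)%:R) *
    (1 + expR 1 * V / n1) ^+ m)%:E)%E.
Proof.
have n0 := region_volume_fine_gt0 L1_gt0.
have V0 : 0 <= V by rewrite -lee_fin; exact: le_trans V_ball.
have c0 : 0 <= expR 1 * V / n1 by rewrite divr_ge0 ?mulr_ge0 ?expR_ge0// ltW.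
elim: m k => [|m ih] k kK.
  by rewrite count_mean_start// lee_fin expr0 mulr1 mulr_ge0 ?expR_ge0 ?mulr_ge0// ltW.
have [kltK|] := ltnP k K; last first.
  move=> Kk; have -> : k = K by apply/eqP; rewrite eqn_leq kK.
  apply: (le_trans (count_mean_top _)); rewrite lee_fin subnn oppr0 expR0 mulr1.
  by apply: ler_peMr; [rewrite mulr_ge0// ltW|rewrite exprn_ege1// lerDl].
apply: (le_trans (count_meanS m kltK)).
apply: (le_trans (leeD (ih _ kK) (lee_wpmul2l _ (ih _ kltK)))).
  by rewrite lee_fin divr_ge0// ltW.
rewrite -EFinM -EFinD lee_fin exprSr.
have -> : expR (- (K - k.+1)%:R) = expR 1 * expR (- (K - k)%:R) :> R.
  rewrite -expRD; congr expR; rewrite -(subnSK kltK) -natr1; lra.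
rewrite [leRHS]mulrA mulrDr mulr1 lerD2l.
set x := expR 1; set y := expR _; set z := _ ^+ m.
by rewrite le_eqVlt; apply/orP; left; apply/eqP; rewrite -!mulrA; lra.
Qed.

(** Without a discrepancy in [A 0] the two configurations have the same restriction to [I]. By
    Markov's inequality such a discrepancy has probability at most the mean number, which is
    [count_mean_decay] at [k = 0]. *)
Lemma coupling_tv (I : set E) m (B : set config) : measurable I -> I `<=` A 0 ->
  measurable B ->
  (`|hs (restrict_config I @^-1` B) -
     law_at t1 lam local_start m (restrict_config I @^-1` B)| <=
   (2 * n1 * expR (- K%:R) * (1 + expR 1 * V / n1) ^+ m)%:E)%E.
Proof.
move=> mI IA mB; set B' := restrict_config I @^-1` B.
have mB' : measurable B' by exact: (measurable_preimage (measurable_restrict_config mI)).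
have mne : measurable [set p : config * config | (0 < count 0 p)%N].
  rewrite (_ : [set x | _] = (fun p => (count 0 p)%:R : R) @^-1` (`]0, +oo[%classic)).
    exact: (measurable_preimage (measurable_count 0)).
  by apply/seteqP; split => x /=; rewrite in_itv/= andbT ltr0n.
have m1 : measurable (fst @^-1` B' : set (config * config)).
  exact: (measurable_preimage measurable_fst).
have m2 : measurable (snd @^-1` B' : set (config * config)).
  exact: (measurable_preimage measurable_snd).
have agree (p : config * config) : ~ (0 < count 0 p)%N ->
    restrict_config I p.1 = restrict_config I p.2.
  move=> c0; apply/fsetP => y; rewrite !inE/=; apply: andb_id2r => /set_mem Iy.
  apply/idP/idP => yp; apply/negPn/negP => yn; apply: c0; apply/num_points_gt0;
    exists y; rewrite ?in_discrepancy ?yp ?(negPf yn)//; exact: IA.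
set e := joint_law m [set p | (0 < count 0 p)%N].
have eE : (e <= (2 * n1 * expR (- K%:R) * (1 + expR 1 * V / n1) ^+ m)%:E)%E.
  apply: (le_trans (@markov_nat _ _ _ (joint_law m) _ (measurable_count 0))).
  by have := @count_mean_decay 0 m (leq0n _); rewrite subn0.
apply: le_trans eE.
rewrite -(joint_law_fst m mB') -(joint_law_snd m mB').
have le1 : (joint_law m (fst @^-1` B') <= joint_law m (snd @^-1` B') + e)%E.
  apply: (le_trans _ (measureU2 _ m2 mne)); apply: le_measure; rewrite ?inE//.
    exact: measurableU.
  move=> p Bp; have [c|c] := pselect (0 < count 0 p)%N; [by right|left].
  by move: Bp; rewrite /B' /= agree.
have le2 : (joint_law m (snd @^-1` B') <= joint_law m (fst @^-1` B') + e)%E.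
  apply: (le_trans _ (measureU2 _ m1 mne)); apply: le_measure; rewrite ?inE//.
    exact: measurableU.
  move=> p Bp; have [c|c] := pselect (0 < count 0 p)%N; [by right|left].
  by move: Bp; rewrite /B' /= agree.
have f1 := fin_num_measure (joint_law m) _ m1.
have f2 := fin_num_measure (joint_law m) _ m2.
have f3 : e \is a fin_num := fin_num_measure (joint_law m) _ mne.
move: le1 le2; rewrite -(fineK f1) -(fineK f2) -(fineK f3) -!EFinD !lee_fin => le1 le2.
by rewrite ler_norml; apply/andP; split; lra.
Qed.

End coupling.

(** * The window *)

Section levels.
Context (R : realType) (d : nat) (r : R).
Local Notation E := 'rV[R]_d.
Local Notation config := (config R d).
Hypothesis r_gt0 : 0 < r.
Variable P : config.

(* A substitute for the 2r(k+1)-neighbourhood of L'_Int, P being a maximal packing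
   of it: the number of balls, hence the volume, is controlled by |L'|. *)
Definition level (k : nat) : set E :=
  \bigcup_(y in [set` P]) closed_euclidean_ball y (2 * r * k.+1%:R).

Lemma closed_level k : closed (level k).
Proof.
by apply: closed_bigcup => // y _; exact: closed_closed_euclidean_ball.
Qed.

Lemma measurable_level k : measurable (level k).
Proof. by apply: closed_measurable_rV; exact: closed_level. Qed.

Lemma level_next k x y : level k x -> euclidean_dist x y < 2 * r -> level k.+1 y.
Proof.
move=> [z zP zx] xy; exists z => //=.
rewrite /closed_euclidean_ball /= -[k.+2]addn1 natrD mulrDr mulr1.
by apply: (le_trans (euclidean_dist_triangle x _ _)); rewrite lerD// ltW.
Qed.

Lemma lebesgue_level k :
  (lebesgue_rV (level k) <= (#|` P|%:R * (4 * r * k.+1%:R) ^+ d)%:E)%E.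
Proof.
have mb (y : E) l : measurable (closed_euclidean_ball y l).
  by apply: closed_measurable_rV; exact: closed_closed_euclidean_ball.
set w := 2 * r * k.+1%:R; have w0 : 0 <= w by rewrite !mulr_ge0// ltW.
have -> : lebesgue_rV (level k) = (\int[@lebesgue_rV R d]_x (\1_(level k) x)%:E)%E.
  by rewrite integral_indic ?setIT//; exact: measurable_level.
apply: (@le_trans _ _ (\int[@lebesgue_rV R d]_x
    \sum_(y <- P) (\1_(closed_euclidean_ball y w) x)%:E)%E).
  apply: ge0_le_integral => //.
  - by apply/measurable_EFinP; apply: measurable_indic; exact: measurable_level.
  - apply: emeasurable_sum => y; apply/measurable_EFinP; exact: measurable_indic.
  move=> x _; rewrite sumEFin lee_fin.
  have [[y yP yx]|nx] := pselect (level k x); last first.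
    by rewrite indicE memNset//; exact: sumr_ge0.
  rewrite (big_fsetD1 y)//= [X in _ <= X + _]indicE mem_set//.
  by rewrite indicE; case: (_ \in _) => /=; rewrite ?lerDl ?addr_ge0//; exact: sumr_ge0.
rewrite ge0_integral_sum//; last first.
  by move=> y; apply/measurable_EFinP; exact: measurable_indic.
rewrite card_fset_sum1 natr_sum mulr_suml -sumEFin; apply: lee_sum => y _.
(* [2 * w] is the side of the cube circumscribed to a ball of radius [w]. *)
rewrite integral_indic// setIT mul1r (_ : 4 * r * k.+1%:R = 2 * w).
  exact: lebesgue_closed_euclidean_ball_le.
rewrite /w; lra.
Qed.

End levels.

Lemma boundary_condition_eq (R : realType) (d : nat) (r : R) (L : region R d)
    (t t' : boundary_condition r L) : t = t' :> set _ -> t = t'.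
Proof.
case: t => f m s; case: t' => f' m' s' /= ff; subst f'.
by rewrite (Prop_irrelevance m m') (Prop_irrelevance s s').
Qed.

Lemma abse_sub_chain (R : realType) (a1 a2 b1 b2 : \bar R) (x y : R) :
  a1 \is a fin_num -> a2 \is a fin_num -> b1 \is a fin_num -> b2 \is a fin_num ->
  (`|a1 - b1| <= x%:E)%E -> (`|a2 - b2| <= x%:E)%E -> (`|b1 - b2| <= y%:E)%E ->
  (`|a1 - a2| <= (2 * x + y)%:E)%E.
Proof.
case: a1 => [a1| |]// ; case: a2 => [a2| |]//; case: b1 => [b1| |]//; case: b2 => [b2| |]//.
move=> _ _ _ _; rewrite -!EFinB !abse_EFin !lee_fin !ler_norml.
move=> /andP[? ?] /andP[? ?] /andP[? ?]; apply/andP; split; lra.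
Qed.

Lemma le_tv_dist d (T : measurableType d) (R : realType) (mu nu : set T -> \bar R)
    (A : set T) : measurable A -> (`|mu A - nu A| <= tv_dist mu nu)%E.
Proof. by move=> mA; apply: ereal_sup_ubound; exists A. Qed.

(** * Comparison of two boundary conditions through the window *)

Section spatial_estimate.
Context (R : realType) (d : nat) (d_gt0 : (0 < d)%N) (r : R) (lam : {posnum R}).
Local Notation E := 'rV[R]_d.
Local Notation config := (config R d).
Local Notation leb := (@lebesgue_rV R d).
Hypothesis r_gt0 : 0 < r.
Hypothesis r_unit_ball : leb (euclidean_ball (0 : E) r) = 1%E.
Variables (L' L : region R d) (L'L : L' `<=` L).
Variables (P : config) (PL' : packings r (r_interior r L') P).
Hypothesis P_max : forall x, r_interior r L' x ->
  exists2 y, y \in P & euclidean_dist x y < 2 * r.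
Variable (x0 : E) (L'x0 : r_interior r L' x0).
Variable K : nat.

Lemma compact_local_region : compact (L `&` level r P K.+1).
Proof.
by apply: compact_closedI; [exact: region_compact|exact: closed_level].
Qed.

Lemma measurable_local_region : measurable (L `&` level r P K.+1).
Proof.
by apply: measurableI; [exact: region_measurable|exact: measurable_level].
Qed.

(** One level beyond level [K], where centers may move: the ball of radius [r] around an admissible
    center in [level r P K] then lies in the region, so that the center is in its [r]-interior and
    is deleted at full rate. *)
Definition local_region : region R d :=
  Region compact_local_region measurable_local_region.

Lemma r_interior_level0 : r_interior r L' `<=` level r P 0.
Proof.
move=> x /P_max[y yP xy]; exists y => //=.
by rewrite /closed_euclidean_ball /= mulr1 euclidean_distC ltW.
Qed.

Lemma ball_sub_local_region (t : boundary_condition r L) y :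
  centers t y -> level r P K y -> euclidean_ball y r `<=` local_region.
Proof.
move=> /centers_sub /ball_sub_r_interior BL By z yz; split; first exact: BL.
by apply: level_next By _ => //; apply: (lt_trans yz); rewrite ltr_pMl ?ltr1n.
Qed.

Lemma local_region_gt0 : (0 < leb local_region)%E.
Proof.
have [y yP _] := P_max L'x0.
apply: (@lt_le_trans _ _ 1%E) => //.
rewrite -r_unit_ball -(lebesgue_euclidean_ball y); apply: le_measure; rewrite ?inE.
- exact: measurable_euclidean_ball.
- exact: measurable_local_region.
move=> z yz; split; first by apply: L'L; apply: (ball_sub_r_interior (PL'.1 _ yP)) yz.
have y0 : level r P 0 y by exists y => //; rewrite /closed_euclidean_ball /= euclidean_distxx mulr1 mulr_ge0// ltW.
apply: (@level_next _ _ _ _ _ y) => //.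
  exact: (level_subset r_gt0 (@level_next R d r P) (leq0n K)).
by apply: (lt_trans yz); rewrite ltr_pMl ?ltr1n.
Qed.

Lemma local_region_volume :
  fine (leb local_region) <= fine (leb L') * (4 * r * K.+2%:R) ^+ d.
Proof.
have volE : (fine (leb L'))%:E = leb L'.
  rewrite fineK// ge0_fin_numE//.
  by apply: lebesgue_rV_compact_lty; [exact: region_compact|exact: region_measurable].
rewrite -lee_fin -region_volume_fin.
apply: (@le_trans _ _ (leb (level r P K.+1))).
  apply: le_measure; rewrite ?inE; [exact: measurable_local_region|exact: measurable_level|].
  by move=> x [].
apply: (le_trans (lebesgue_level r_gt0 P K.+1)); rewrite lee_fin ler_wpM2r//.
  by rewrite exprn_ge0// !mulr_ge0// ltW.
by rewrite -lee_fin volE; exact: (packing_volume r_unit_ball (@region_measurable _ _ L') PL').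
Qed.

Variable t : boundary_condition r L.

(** Forbidding everything but the centers of [t] in [level r P K] makes the window depend on [t]
    only through what lies in that level. *)
Definition local_forbidden : set E :=
  r_interior r local_region `\` (centers t `&` level r P K).

Lemma measurable_local_forbidden : measurable local_forbidden.
Proof.
apply: measurableD.
  by apply: measurable_r_interior; exact: measurable_local_region.
by apply: measurableI; [exact: measurable_centers|exact: measurable_level].
Qed.

Lemma local_forbidden_sub : local_forbidden `<=` r_interior r local_region.
Proof. by move=> x []. Qed.

Definition local_condition : boundary_condition r local_region :=
  BoundaryCondition measurable_local_forbidden local_forbidden_sub.

Lemma centers_local_condition : centers local_condition = centers t `&` level r P K.
Proof.
rewrite /centers /= /local_forbidden setDD; apply/setIidr => y [ty ly].
have ballL := ball_sub_local_region ty ly.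
split; first by apply: ballL; rewrite /euclidean_ball /= euclidean_distxx.
apply: le_ereal_inf_tmp => _ [_ -> [z nz <-]]; rewrite lee_fin leNgt.
by apply/negP => yz; apply: nz; exact: ballL.
Qed.

Variable t' : boundary_condition r L.
Hypothesis far : forall x y : E, (t `+` t') x -> region_set L' y -> 2 * r * K.+1%:R < euclidean_dist x y.

(** [P] lies in [L'], so every point of [level r P K] is within [2 * r * K.+1] of [L'], where [t]
    and [t'] agree. The condition built from [t] thus serves [t'] too, and a single chain can be
    compared with both measures. *)
Lemma centers_local_condition' :
  centers local_condition = centers t' `&` level r P K.
Proof.
rewrite centers_local_condition.
have agree x : level r P K x -> forbidden t x <-> forbidden t' x.
  move=> [y yP xy]; have L'y : region_set L' y by exact: (PL'.1 _ yP).1.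
  have nfar : ~ (t `+` t') x.
    move=> /far /(_ L'y); rewrite ltNge euclidean_distC => /negP; exact.
  by split => tx; apply: contrapT => nt; apply: nfar; [left|right].
apply/seteqP; split => x [[Lx ntx] lx]; split => //; split => // /(agree _ lx);
  exact: ntx.
Qed.

Variables (b c : R).
Hypothesis mixing : forall L : region R d, (0 < leb L)%E ->
  forall (t : boundary_condition r L) (s : R), 0 < s ->
  forall mu0 nu0 : probability config R,
  mu0 (packings r (centers t)) = 1%E -> nu0 (packings r (centers t)) = 1%E ->
  let n := fine (leb L) in
  (tv_dist (law_at t lam mu0 (Num.truncn (s * n)))
           (law_at t lam nu0 (Num.truncn (s * n))) <=
   (b * n * expR (- (c * s)))%:E)%E.

Variable V : R.
Hypothesis V_gt0 : 0 < V.
Hypothesis V_ball : (leb (euclidean_ball (0 : E) (2 * r)) <= V%:E)%E.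
Local Notation n1 := (fine (leb local_region)).

(** Three comparisons: each hard sphere measure with the window chain started from its own trace,
    and the two window laws with each other by [mixing]. The factor 4 comes from two coupling errors
    with prefactor [2 * n1] each. *)
Lemma tv_local (s : R) (B : set config) : 0 < s -> measurable B ->
  (`|hard_sphere lam t (restrict_config (r_interior r L') @^-1` B) -
     hard_sphere lam t' (restrict_config (r_interior r L') @^-1` B)| <=
   (n1 * (4 * expR (- K%:R) * expR (s * (expR 1 * V)) + b * expR (- (c * s))))%:E)%E.
Proof.
move=> s0 mB; set B' := restrict_config _ @^-1` B.
have L1_gt0 := local_region_gt0.
have n0 : 0 < n1 := region_volume_fine_gt0 L1_gt0.
pose m := Num.truncn (s * n1).
have mI : measurable (r_interior r L').
  by apply: measurable_r_interior; exact: region_measurable.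
have mB' : measurable B' by exact: (measurable_preimage (measurable_restrict_config mI)).
have mlev k := @measurable_level R d r P k.
have lnext := @level_next R d r P.
have c1 := coupling_tv d_gt0 lam r_gt0 r_unit_ball mlev lnext centers_local_condition
  L1_gt0 (@ball_sub_local_region t) V_ball m mI r_interior_level0 mB.
have c2 := coupling_tv d_gt0 lam r_gt0 r_unit_ball mlev lnext centers_local_condition'
  L1_gt0 (@ball_sub_local_region t') V_ball m mI r_interior_level0 mB.
have s1 := local_start_packings d_gt0 lam mlev centers_local_condition.
have s2 := local_start_packings d_gt0 lam mlev centers_local_condition'.
have := mixing L1_gt0 s0 s1 s2; rewrite /= -/m => c3.
have {}c3 := le_trans (le_tv_dist _ _ mB') c3.
(* Use [1 + x <= expR x]; there are at most [s * n1] steps, so the volume of the window cancels. *)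
have growth : (1 + expR 1 * V / n1) ^+ m <= expR (s * (expR 1 * V)).
  have u0 : 0 <= expR 1 * V / n1 by rewrite divr_ge0 ?mulr_ge0 ?expR_ge0// ltW.
  apply: (@le_trans _ _ (expR (expR 1 * V / n1) ^+ m)).
    by apply: lerXn2r; rewrite ?nnegrE ?addr_ge0 ?expR_ge0 ?expR_ge1Dx.
  rewrite -expRM_natl ler_expR.
  apply: (@le_trans _ _ (s * n1 * (expR 1 * V / n1))).
    by rewrite ler_wpM2r// truncn_le mulr_ge0// ltW.
  by rewrite mulrACA divff ?mulr1 ?gt_eqF.
have f (Q : probability config R) : Q B' \is a fin_num := fin_num_measure Q _ mB'.
apply: (le_trans (abse_sub_chain (f _) (f _) (f _) (f _) c1 c2 c3)).
rewrite lee_fin.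
have n0' : 0 <= n1 by exact: ltW.
have w0 : 0 <= 4 * n1 * expR (- K%:R) by rewrite !mulr_ge0 ?expR_ge0.
apply: (le_trans (lerD (_ : _ <= 4 * n1 * expR (- K%:R) * expR (s * (expR 1 * V))) (lexx _))).
  apply: le_trans (ler_wpM2l w0 growth); rewrite le_eqVlt; apply/orP; left.
  by rewrite !mulrA -natrM.
by rewrite mulrDr !mulrA (mulrC n1) (mulrC n1 b).
Qed.

End spatial_estimate.

(** Half of the exponential rate absorbs the power of [K.+2], which comes from the volume of the
    window. The choice of [z] makes [d * z] equal to [g / 2 * K + g], and [z ^+ d] is at most
    [expR (d * z)]. *)
Lemma exprn_expR_le (R : realType) (d : nat) (g : R) (K : nat) : (0 < d)%N -> 0 < g ->
  K.+2%:R ^+ d * expR (- (g * K%:R)) <=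
  (2 * d%:R / g) ^+ d * expR g * expR (- (g / 2 * K%:R)).
Proof.
move=> d0 g0; have d0' : 0 < d%:R :> R by rewrite ltr0n.
pose z : R := g * K.+2%:R / (2 * d%:R).
have z0 : 0 <= z by rewrite divr_ge0 ?mulr_ge0// ltW.
have zle : z ^+ d <= expR (g / 2 * K%:R + g).
  rewrite (_ : g / 2 * K%:R + g = d%:R * z).
    rewrite expRM_natl; apply: lerXn2r; rewrite ?nnegrE ?expR_ge0//.
    by apply: le_trans (expR_ge1Dx z); rewrite lerDr.
  rewrite /z invfM mulrCA [X in _ = _ * X]mulrCA divff ?gt_eqF// mulr1.
  by rewrite -[K.+2]addn2 natrD; lra.
have -> : K.+2%:R = 2 * d%:R / g * z :> R.
  have a0 : 2 * d%:R != 0 :> R by rewrite mulf_neq0 ?gt_eqF.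
  rewrite /z; set a := 2 * d%:R in a0 *.
  by rewrite mulrA -(mulrA a) mulKf ?gt_eqF// mulrAC divff ?mul1r.
rewrite exprMn -[leLHS]mulrA -[leRHS]mulrA ler_wpM2l//.
  by rewrite exprn_ge0// divr_ge0 ?mulr_ge0// ltW.
apply: (le_trans (ler_wpM2r (expR_ge0 _) zle)).
by rewrite -!expRD ler_expR; lra.
Qed.

(** * Choice of the constants and degenerate cases *)

Lemma tv_probability_le1 d (T : measurableType d) (R : realType)
    (P Q : probability T R) (A B : set T) : measurable A -> measurable B ->
  (`|P A - Q B| <= 1)%E.
Proof.
move=> mA mB.
have fP : P A \is a fin_num := fin_num_measure P _ mA.
have fQ : Q B \is a fin_num := fin_num_measure Q _ mB.
have := probability_le1 P mA; have := probability_le1 Q mB.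
have p0 : 0 <= fine (P A) by exact: fine_ge0.
have q0 : 0 <= fine (Q B) by exact: fine_ge0.
rewrite -(fineK fP) -(fineK fQ) -EFinB abse_EFin !lee_fin => q1 p1.
by rewrite ler_norml; apply/andP; split; lra.
Qed.

Theorem theorem2p2 (R : realType) (d : nat) (d_ge2 : (2 <= d)%N)
    (r : R) (r_gt0 : 0 < r)
    (r_unit_ball : lebesgue_rV (euclidean_ball (0 : 'rV[R]_d) r) = 1%E)
    (lam : {posnum R}) :
  optimal_temporal_mixing d lam r -> strong_spatial_mixing d lam r.
Proof.
move=> [b [c [b0 c0 mixing]]]; have d_gt0 : (0 < d)%N by exact: ltnW.
(* The volume of the cube circumscribed to a ball of radius [2 * r]. *)
pose V : R := (4 * r) ^+ d.
have V_gt0 : 0 < V by rewrite exprn_gt0// mulr_gt0.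
have V_ball : (lebesgue_rV (euclidean_ball (0 : 'rV[R]_d) (2 * r)) <= V%:E)%E.
  have r2 : 0 <= 2 * r by rewrite mulr_ge0// ltW.
  rewrite /V (_ : 4 * r = 2 * (2 * r)); last by lra.
  apply: le_trans (lebesgue_closed_euclidean_ball_le 0 r2).
  apply: le_measure; rewrite ?inE; first exact: measurable_euclidean_ball.
    by apply: closed_measurable_rV; exact: closed_closed_euclidean_ball.
  by move=> y; exact: ltW.
pose v := expR 1 * V; have v0 : 0 < v by rewrite mulr_gt0// expR_gt0.
(* The decay rate per layer when [s = K / (2 * v)]: the coupling error [expR (- K) * expR (s * v)]
   has rate [1 / 2], the mixing error [expR (- (c * s))] has rate [c / (2 * v)]. *)
pose g := Num.min (1 / 2) (c / (2 * v)).
have g0 : 0 < g by rewrite lt_min !divr_gt0// mulr_gt0.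
(* [4 + b] collects the two terms of [tv_local], [(4 * r) ^+ d] comes from the volume of the window,
   the rest from [exprn_expR_le]. *)
pose C := (4 + b) * (4 * r) ^+ d * ((2 * d%:R / g) ^+ d * expR g).
have C0 : 0 <= C.
  rewrite !mulr_ge0 ?expR_ge0 ?exprn_ge0 ?addr_ge0 ?divr_ge0 ?mulr_ge0//; exact: ltW.
(* A rate [g / 2] remains per layer of width [2 * r]. The factor [expR (3 * g / 2)] in [beta] pays
   for the at most three layers lost to rounding and to the margin in [K]. *)
pose alpha := g / (4 * r).
pose beta := (C + 1) * expR (3 * g / 2).
have alpha0 : 0 < alpha by rewrite divr_gt0// mulr_gt0.
have beta0 : 0 < beta by rewrite mulr_gt0 ?expR_gt0// ltr_wpDl.
exists alpha, beta; split => // L' L L'L t t'.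
have mI : measurable (r_interior r L').
  by apply: measurable_r_interior; exact: region_measurable.
have mL' := @region_measurable _ _ L'.
have L'oo : (lebesgue_rV L' < +oo)%E.
  by apply: lebesgue_rV_compact_lty => //; exact: region_compact.
set bound := (_ * _ * _)%E.
have bound0 : (0 <= bound)%E.
  by rewrite !mule_ge0 ?expeR_ge0// lee_fin ltW.
apply: ge_ereal_sup => _ [B mB <-]; rewrite /pushforward.
set B' := _ @^-1` B.
have mB' : measurable B' by exact: (measurable_preimage (measurable_restrict_config mI)).
(* If the [r]-interior of [L'] is empty, |L'| and with it the bound may be 0; but then the
   projection is constant. *)
have [[x0 L'x0]|/forallNP empty] := pselect (exists x, r_interior r L' x); last first.
  have [BT|B0] : B' = setT \/ B' = set0.
    have rE X : restrict_config (r_interior r L') X = fset0.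
      apply/fsetP => y; rewrite !inE/=; apply/negP => /andP[_ /set_mem].
      exact: empty.
    have [Be|Be] := pselect (B fset0); [left|right].
      by apply/seteqP; split => X //= _; rewrite /B' /= rE.
    by apply/seteqP; split => X //=; rewrite /B' /= rE.
  - rewrite BT (probability_setT (hard_sphere lam t)).
    by rewrite (probability_setT (hard_sphere lam t')) subee// abse0.
  - rewrite B0 (measure0 (hard_sphere lam t)) (measure0 (hard_sphere lam t')).
    by rewrite subee// abse0.
(* Equal boundary conditions are at distance [+oo], so the bound is 0 and the two measures have to
   coincide. *)
have [tt|/eqP/set0P[x1 tx1]] := pselect (t `+` t' = set0).
  suff -> : t = t' by rewrite subee ?abse0//; exact: fin_num_measure.
  apply: boundary_condition_eq; apply/seteqP; split => x tx; apply: contrapT => nx.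
    by have : (t `+` t') x by [left]; rewrite tt.
  by have : (t `+` t') x by [right]; rewrite tt.
set S := t `+` t' in tx1 bound bound0 *.
have L'x : region_set L' x0 by case: L'x0.
have dist0 : (0 <= set_dist S L')%E.
  by apply: le_ereal_inf_tmp => _ [x _ [y _ <-]]; rewrite lee_fin euclidean_dist_ge0.
have dist_le x y : S x -> region_set L' y -> (set_dist S L' <= (euclidean_dist x y)%:E)%E.
  by move=> Sx L'y; apply: ereal_inf_lbound; exists x => //; exists y.
pose D := fine (set_dist S L').
have DE : set_dist S L' = D%:E.
  by rewrite fineK// ge0_fin_numE// (le_lt_trans (dist_le _ _ tx1 L'x))// ltry.
pose v1 := fine (lebesgue_rV L').
have v1E : lebesgue_rV L' = v1%:E by rewrite fineK// ge0_fin_numE.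
(* [L'] contains a ball of volume 1; this makes the trivial bound usable at small distances. *)
have v1_ge1 : 1 <= v1.
  rewrite -lee_fin -v1E -r_unit_ball -(lebesgue_euclidean_ball x0).
  apply: le_measure; rewrite ?inE//; first exact: measurable_euclidean_ball.
  exact: ball_sub_r_interior L'x0.
have boundE : bound = (beta * v1 * expR (- (alpha * D)))%:E.
  by rewrite /bound v1E DE -EFinM.
have D0 : 0 <= D by rewrite -lee_fin -DE.
have r20 : 0 < 2 * r by rewrite mulr_gt0.
have Dr0 : 0 <= D / (2 * r) by rewrite divr_ge0// ltW.
have alphaDE : alpha * D = g / 2 * (D / (2 * r)).
  rewrite /alpha (_ : 4 * r = 2 * (2 * r)); last by lra.
  by rewrite invfM !mulrA mulrAC.
set k0 := Num.truncn (D / (2 * r)).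
have [/andP[k0D Dk0]] : k0%:R <= D / (2 * r) < k0.+1%:R by exact: truncn_itv.
(* With less than three layers [beta] alone outweighs the exponential, and total variation is at
   most 1. *)
rewrite boundE; have [k0small|k0big] := leqP k0 2.
  apply: (le_trans (tv_probability_le1 _ _ mB' mB')); rewrite lee_fin.
  have aD : alpha * D <= 3 * g / 2.
    have : D / (2 * r) <= 3 by apply: ltW; apply: (lt_le_trans Dk0); rewrite ler_nat.
    rewrite alphaDE => /(ler_wpM2l (ltW g0)); lra.
  apply: (@le_trans _ _ (1 * v1 * 1)); first by rewrite mul1r mulr1.
  rewrite -mulrA -[leRHS]mulrA /beta mul1r mulr1 -mulrA.
  rewrite [X in _ <= _ * X]mulrCA -expRD.
  apply: (@le_trans _ _ (1 * (v1 * expR 0))); first by rewrite mul1r expR0 mulr1.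
  by rewrite ler_pM ?mulr_ge0 ?expR_ge0 ?lerDr ?ler_wpM2l ?ler_expR//; lra.
have [P PL' P_max] := maximal_packing r_gt0 r_unit_ball mL' L'oo.
(* The strict inequality in [far], forced by the closed balls of [level], asks for [K.+1] strictly
   below [D / (2 * r)], hence [k0 = K.+2]. Here [K] is positive, which [s > 0] requires. *)
pose K := (k0 - 2)%N.
have K0 : 0 < K%:R :> R by rewrite ltr0n subn_gt0.
have k0E : k0%:R = K%:R + 2 :> R by rewrite -natrD subnK// ltnW.
have far x y : S x -> region_set L' y -> 2 * r * K.+1%:R < euclidean_dist x y.
  move=> Sx L'y; have := dist_le x y Sx L'y; rewrite DE lee_fin.
  apply: lt_le_trans; rewrite -ltr_pdivlMl// mulrC; apply: lt_le_trans k0D.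
  by rewrite k0E -natr1 ltrD2l ltr1n.
pose s := K%:R / (2 * v).
have s0 : 0 < s by rewrite divr_gt0// mulr_gt0.
apply: (le_trans (tv_local d_gt0 r_gt0 r_unit_ball L'L PL' P_max L'x0 far mixing V_gt0 V_ball s0 mB)).
set n1 := fine _; rewrite lee_fin.
have n1_le : n1 <= v1 * (4 * r * K.+2%:R) ^+ d.
  exact: (local_region_volume r_gt0 r_unit_ball _ PL').
have n10 : 0 <= n1 by exact: fine_ge0.
have v_neq0 : v != 0 by rewrite gt_eqF.
have g_half : g <= 1 / 2 by rewrite ge_min lexx.
have g_c : g <= c / (2 * v) by rewrite ge_min lexx orbT.
have e1 : expR (- K%:R) * expR (s * (expR 1 * V)) <= expR (- (g * K%:R)).
  rewrite -expRD ler_expR -/v (_ : s * v = K%:R / 2); last first.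
    by rewrite /s invfM (mulrA K%:R) mulfVK.
  have := ler_wpM2r (ltW K0) g_half; lra.
have e2 : expR (- (c * s)) <= expR (- (g * K%:R)).
  rewrite ler_expR lerN2 (_ : c * s = c / (2 * v) * K%:R).
    by rewrite ler_wpM2r// ltW.
  by rewrite /s mulrA mulrAC.
have e3 := exprn_expR_le K d_gt0 g0.
have e4 : expR (- (g / 2 * K%:R)) <= expR (3 * g / 2) * expR (- (alpha * D)).
  rewrite -expRD ler_expR alphaDE.
  have DK : D / (2 * r) <= K%:R + 3.
    apply: ltW; apply: (lt_le_trans Dk0); rewrite -natr1 k0E; lra.
  have g2 : 0 <= g / 2 by rewrite divr_ge0// ltW.
  have := ler_wpM2l g2 DK; lra.
set w := expR (- (g * K%:R)) in e1 e2 e3.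
have w0 : 0 <= w by exact: expR_ge0.
have v1_ge0 : 0 <= v1 by exact: le_trans v1_ge1.
have r4 : 0 <= (4 * r) ^+ d by rewrite exprn_ge0// mulr_ge0// ltW.
have b4 : 0 <= 4 + b by rewrite addr_ge0// ltW.
apply: (@le_trans _ _ (n1 * ((4 + b) * w))).
  rewrite ler_wpM2l// [leRHS]mulrDl lerD//.
    by rewrite -mulrA ler_wpM2l.
  by rewrite ler_wpM2l// ltW.
apply: (@le_trans _ _ (v1 * (4 * r * K.+2%:R) ^+ d * ((4 + b) * w))).
  by rewrite ler_wpM2r// mulr_ge0.
apply: (@le_trans _ _ (v1 * (C * expR (- (g / 2 * K%:R))))).
  rewrite -mulrA ler_wpM2l// /C exprMn.
  apply: (@le_trans _ _ ((4 + b) * (4 * r) ^+ d * (K.+2%:R ^+ d * w))).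
    by rewrite le_eqVlt; apply/orP; left; apply/eqP; rewrite mulrCA !mulrA.
  by rewrite -[leRHS]mulrA ler_wpM2l// mulr_ge0.
rewrite -[leRHS]mulrA [leRHS]mulrCA ler_wpM2l// /beta -[leRHS]mulrA.
apply: ler_pM => //.
by rewrite lerDl.
Qed.
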